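(* (I) Let $\mu$ be a Borel measure on $F^{m\times n}$ which is contracting almost everywhere, and suppose that $\omega(Y)=\eta$ for $\mu$-a.e. $Y\in F^{m\times n}$. Then for every $\boldsymbol\theta\in F^m$, $\omega(Y,\boldsymbol\theta)\le\eta$ for $\mu$-a.e. $Y\in F^{m\times n}$. (II) Let $\mu$ be a Borel measure on $F^{m\times n}$ which is strongly contracting almost everywhere, and suppose that $\omega^\times(Y)=\eta$ for $\mu$-a.e. $Y\in F^{m\times n}$. Then for every $\boldsymbol\theta\in F^m$, $\omega^\times(Y,\boldsymbol\theta)\le\eta$ for $\mu$-a.e. $Y\in F^{m\times n}$.
   Context: Let $q=p^d$ with $p$ prime, $\Lambda=\mathbb{F}_q[X]$ and $F=\mathbb{F}_q((X^{-1}))$, with absolute value $|0|=0$ and $|\sum_{\ell\le \ell_0}a_\ell X^\ell|=e^{\ell_0}$ when $a_{\ell_0}\neq0$. Vectors in $F^k$ carry the sup norm; $F^{m\times n}$ is identified with $F^{mn}$ with the sup norm. For $\mathbf y\in F^m$ put $\prod(\mathbf y)=\prod_{j}|y_j|$, and for $\mathbf q\in\Lambda^n$ put $\prod_+(\mathbf q)=\prod_{i}\max\{1,|q_i|\}$. For $Y\in F^{m\times n}$, $\boldsymbol\theta\in F^m$: $\omega(Y,\boldsymbol\theta)$ is the supremum of reals $\omega\ge0$ such that for arbitrarily large $T\ge1$ there is $(\mathbf p,\mathbf q)\in\Lambda^m\times(\Lambda^n\setminus\{0\})$ with $\|Y\mathbf q+\mathbf p+\boldsymbol\theta\|^m<e^{-\omega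 T}$ and $\|\mathbf q\|^n<e^T$; $\omega^\times(Y,\boldsymbol\theta)$ is defined the same way with conditions $\prod(Y\mathbf q+\mathbf p+\boldsymbol\theta)<e^{-\omega T}$ and $\prod_+(\mathbf q)<e^T$. $\omega(Y)=\omega(Y,\mathbf 0)$, $\omega^\times(Y)=\omega^\times(Y,\mathbf 0)$. For a ball $B$ and $a>0$, $aB$ is the concentric ball with $a$ times the radius. The support $S$ of $\mu$ is the smallest closed set of full measure. $\mu$ is non-atomic if points have measure $0$, and doubling if there is $c>0$ with $\mu(2B)\le c\mu(B)$ for every ball $B$ centred in $S$. For $\mathbf b\in F^n$ with $\|\mathbf b\|=1$, $\mathbf c\in F^m$ and $\boldsymbol\varepsilon\in(0,\infty)^m$, $\mathcal L_{\mathbf b,\mathbf c}^{(\boldsymbol\varepsilon)}=\{Y:|Y_i\mathbf b+c_i|<\varepsilon_i\ \forall i\}$ ($Y_i$ the $i$-th row). A finite, non-atomic, doubling Borel measure $\mu$ on $F^{m\times n}$ is strongly contracting if there are $C,\alpha,r_0>0$ such that for all such $\mathbf b,\mathbf c$, every $\boldsymbol\varepsilon$ with $\min_j\varepsilon_j<r_0$ and every $0<\delta<1$: for every $Y\in\mathcal L_{\mathbf b,\mathbf c}^{(\delta\boldsymbol\varepsilon)}\cap S$ there is an open ball $B$ centred at $Y$ with $B\cap S\subset\mathcal L_{\mathbf b,\mathbf c}^{(\boldsymbol\varepsilon)}$ and $\mu(5B\cap\mathcal L_{\mathbf b,\mathbf c}^{(\delta\boldsymbol\varepsilon)})\le C\delta^\alpha\mu(5B)$;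 it is contracting if this holds for all $\boldsymbol\varepsilon$ with equal entries. $\mu$ is (strongly) contracting almost everywhere if for $\mu$-a.e. $Y_0$ there is a neighbourhood $V$ of $Y_0$ with $\mu|_V$ (strongly) contracting. *)

(* Defs.v *)
From HB Require Import structures.
From mathcomp Require Export all_boot all_order all_algebra.
From mathcomp Require Export all_classical all_reals all_analysis.
From mathcomp Require Import zify.

Set Implicit Arguments.
Unset Strict Implicit.
Unset Printing Implicit Defensive.

Import Order.TTheory GRing.Theory Num.Theory.

#[global] Open Scope classical_set_scope.
#[global] Open Scope ring_scope.

(* [laurent K] is the field K((X^-1)): [lcoef x l] is the coefficient of X^l,
   and the exponents that occur are bounded above. *)
Record laurent (K : fieldType) := Laurent {
  lcoef : int -> K;
  lcoef_bound : exists N : int, forall l, N < l -> lcoef l = 0 }.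

Section LaurentField.
Variable K : fieldType.
Local Notation F := (laurent K).
Implicit Types (x y z : F) (l N M : int).

HB.instance Definition _ := gen_eqMixin F.
HB.instance Definition _ := gen_choiceMixin F.

Lemma laurentP x y : lcoef x =1 lcoef y -> x = y.
Proof.
case: x y => [a ha] [b hb] /= /funext ab; subst b.
by rewrite (Prop_irrelevance ha hb).
Qed.

Definition lbound x N := forall l, N < l -> lcoef x l = 0.

Lemma lbound_le x N M : N <= M -> lbound x N -> lbound x M.
Proof. by move=> NM h l /(le_lt_trans NM)/h. Qed.

Fact lzero_bound : exists N : int, forall l, N < l -> (0 : K) = 0.
Proof. by exists 0. Qed.
Definition lzero : F := Laurent lzero_bound.

Fact lopp_bound x : exists N : int, forall l, N < l -> - lcoef x l = 0.
Proof. by have [N h] := lcoef_bound x; exists N => l /h ->; rewrite oppr0. Qed.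
Definition lopp x : F := Laurent (lopp_bound x).

Fact ladd_bound x y :
  exists N : int, forall l, N < l -> lcoef x l + lcoef y l = 0.
Proof.
have [N h] := lcoef_bound x; have [M k] := lcoef_bound y.
exists (Num.max N M) => l; rewrite gt_max => /andP[/h -> /k ->].
by rewrite addr0.
Qed.
Definition ladd x y : F := Laurent (ladd_bound x y).

Fact laddA : associative ladd.
Proof. by move=> x y z; apply: laurentP => l /=; rewrite addrA. Qed.
Fact laddC : commutative ladd.
Proof. by move=> x y; apply: laurentP => l /=; rewrite addrC. Qed.
Fact ladd0 : left_id lzero ladd.
Proof. by move=> x; apply: laurentP => l /=; rewrite add0r. Qed.
Fact laddN : left_inverse lzero lopp ladd.
Proof. by move=> x; apply: laurentP => l /=; rewrite addNr. Qed.

HB.instance Definition _ := GRing.isZmodule.Build F laddA laddC ladd0 laddN.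

Lemma lcoef0 l : lcoef (0 : F) l = 0. Proof. by []. Qed.
Lemma lcoefN x l : lcoef (- x) l = - lcoef x l. Proof. by []. Qed.
Lemma lcoefD x y l : lcoef (x + y) l = lcoef x l + lcoef y l.
Proof. by []. Qed.
Lemma lcoefB x y l : lcoef (x - y) l = lcoef x l - lcoef y l.
Proof. by []. Qed.

(* The convolution sum has finitely many nonzero terms. *)
Definition lconv x y l : K :=
  \sum_(i \in [set: int]) lcoef x i * lcoef y (l - i).

Lemma lconvE x y N M (k : nat) : lbound x N -> lbound y M ->
  lconv x y (N + M - k%:Z) =
  \sum_(i < k.+1) lcoef x (N - i%:Z) * lcoef y (M - (k - i)%N%:Z).
Proof.
move=> hx hy; rewrite /lconv.
rewrite (fsbigE [seq N - i%:Z | i <- iota 0 k.+1]).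
- rewrite big_mkcond big_map -/(index_iota 0 k.+1) big_mkord.
  apply: eq_bigr => i _; rewrite in_setT; congr (_ * lcoef y _).
  by have := ltn_ord i; lia.
- by rewrite map_inj_uniq ?iota_uniq// => i j; lia.
- by [].
- move=> i _ /mapP hi; have [/hx -> |iN] := ltP N i; first by rewrite mul0r.
  rewrite hy ?mulr0// ltNge; apply/negP => iM; apply: hi.
  by exists (absz (N - i)); [rewrite mem_iota|]; lia.
Qed.

Lemma lconv_gt x y N M : lbound x N -> lbound y M ->
  forall l, N + M < l -> lconv x y l = 0.
Proof.
move=> hx hy l NMl; apply: fsbig1 => i _.
have [/hx -> |iN] := ltP N i; first by rewrite mul0r.
by rewrite hy ?mulr0//; lia.
Qed.

Fact lmul_bound x y : exists N : int, forall l, N < l -> lconv x y l = 0.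
Proof.
have [N h] := lcoef_bound x; have [M k] := lcoef_bound y.
by exists (N + M); exact: lconv_gt.
Qed.
Definition lmul x y : F := Laurent (lmul_bound x y).

Fact lone_bound :
  exists N : int, forall l, N < l -> (if l == 0 then 1 else 0 : K) = 0.
Proof. by exists 0 => l; case: eqP => // ->. Qed.
Definition lone : F := Laurent lone_bound.

Let tpol x N n : {poly K} := \poly_(k < n) lcoef x (N - k%:Z).

Lemma lmul_tpol x y N M n k : lbound x N -> lbound y M -> (k < n)%N ->
  lcoef (lmul x y) (N + M - k%:Z) = (tpol x N n * tpol y M n)`_k.
Proof.
move=> hx hy kn; rewrite /= lconvE// coefM; apply: eq_bigr => i _.
rewrite !coef_poly (leq_ltn_trans _ kn) ?leq_ord//.
by rewrite (leq_ltn_trans _ kn) ?leq_subr.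
Qed.

Lemma laurent_ext x y N : lbound x N -> lbound y N ->
  (forall k : nat, lcoef x (N - k%:Z) = lcoef y (N - k%:Z)) -> x = y.
Proof.
move=> hx hy h; apply: laurentP => l.
have [Nl|lN] := ltP N l; first by rewrite hx ?hy.
by have := h (absz (N - l)); rewrite (_ : N - _ = l)//; lia.
Qed.

Lemma lbound_mul x y N M :
  lbound x N -> lbound y M -> lbound (lmul x y) (N + M).
Proof. by move=> hx hy l; exact: lconv_gt. Qed.

Lemma coefM_trunc (p q r : {poly K}) k :
  (forall i, (i <= k)%N -> p`_i = q`_i) -> (p * r)`_k = (q * r)`_k.
Proof.
move=> h; rewrite !coefM; apply: eq_bigr => i _.
by rewrite h// -ltnS.
Qed.

Lemma tpol_mul x y N M n k : lbound x N -> lbound y M -> (k < n)%N ->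
  (tpol (lmul x y) (N + M) n)`_k = (tpol x N n * tpol y M n)`_k.
Proof. by move=> hx hy kn; rewrite coef_poly kn; exact: lmul_tpol. Qed.

Fact lmulC : commutative lmul.
Proof.
move=> x y; have [N hx] := lcoef_bound x; have [M hy] := lcoef_bound y.
apply: (@laurent_ext _ _ (N + M)); [exact: lbound_mul| |move=> k].
  by rewrite addrC; exact: lbound_mul.
by rewrite (lmul_tpol hx hy (ltnSn k)) [N + M]addrC
  (lmul_tpol hy hx (ltnSn k)) mulrC.
Qed.

Fact lmulA : associative lmul.
Proof.
move=> x y z; have [N hx] := lcoef_bound x; have [M hy] := lcoef_bound y.
have [P hz] := lcoef_bound z.
have hxy := lbound_mul hx hy; have hyz := lbound_mul hy hz.
apply: (@laurent_ext _ _ (N + M + P)); [|exact: lbound_mul|move=> k].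
  by rewrite -addrA; exact: lbound_mul.
rewrite [RHS](lmul_tpol hxy hz (ltnSn k)) -[N + M + P]addrA.
rewrite [LHS](lmul_tpol hx hyz (ltnSn k)) mulrC.
have -> : (tpol (lmul y z) (M + P) k.+1 * tpol x N k.+1)`_k
        = (tpol y M k.+1 * tpol z P k.+1 * tpol x N k.+1)`_k.
  by apply: coefM_trunc => i ik; exact: tpol_mul.
have -> : (tpol (lmul x y) (N + M) k.+1 * tpol z P k.+1)`_k
        = (tpol x N k.+1 * tpol y M k.+1 * tpol z P k.+1)`_k.
  by apply: coefM_trunc => i ik; exact: tpol_mul.
by rewrite mulrC mulrA.
Qed.

Lemma lbound_one : lbound lone 0.
Proof. by move=> l /=; case: eqP => // ->. Qed.

Fact lmul1 : left_id lone lmul.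
Proof.
move=> x; have [N hx] := lcoef_bound x.
have h1 := lbound_mul lbound_one hx.
apply: (@laurent_ext _ _ N) => //; first by rewrite -[N]add0r.
move=> k; rewrite -[N in LHS]add0r (lmul_tpol lbound_one hx (ltnSn k)).
rewrite (_ : tpol lone 0 k.+1 = 1) ?mul1r ?coef_poly ?ltnSn//.
apply/polyP => i; rewrite coef_poly coef1 /=.
by case: i => [|i] //=; rewrite if_same.
Qed.

Fact lmulDl : left_distributive lmul +%R.
Proof.
move=> x y z; have [N hx] := lcoef_bound x; have [M hy] := lcoef_bound y.
have [P hz] := lcoef_bound z; pose Q := Num.max N M.
have {}hx : lbound x Q by apply: lbound_le hx; rewrite le_max lexx.
have {}hy : lbound y Q by apply: lbound_le hy; rewrite le_max lexx orbT.
have hxy : lbound (x + y) Q by move=> l Ql; rewrite lcoefD hx ?hy ?addr0.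
have hxz := lbound_mul hx hz; have hyz := lbound_mul hy hz.
apply: (@laurent_ext _ _ (Q + P)); first exact: lbound_mul.
  by move=> l Ql; rewrite lcoefD hxz ?hyz ?addr0.
move=> k; rewrite lcoefD (lmul_tpol hxy hz (ltnSn k)).
rewrite (lmul_tpol hx hz (ltnSn k)) (lmul_tpol hy hz (ltnSn k)).
rewrite -coefD -mulrDl.
suff -> : tpol (x + y) Q k.+1 = tpol x Q k.+1 + tpol y Q k.+1 by [].
apply/polyP => i; rewrite coefD !coef_poly.
by case: ifP; rewrite ?addr0.
Qed.

Fact lone_neq0 : lone != 0.
Proof.
apply/eqP => /(congr1 (fun x : F => lcoef x 0)) /= /eqP.
by rewrite oner_eq0.
Qed.

HB.instance Definition _ := GRing.Zmodule_isComNzRing.Build F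
  lmulA lmulC lmul1 lmulDl lone_neq0.

Lemma lcoefM x y l :
  lcoef (x * y) l = \sum_(i \in [set: int]) lcoef x i * lcoef y (l - i).
Proof. by []. Qed.
Lemma lcoef1 l : lcoef (1 : F) l = if l == 0 then 1 else 0.
Proof. by []. Qed.

Lemma laurent_lead x : x != 0 ->
  exists l, lcoef x l != 0 /\ forall k, l < k -> lcoef x k = 0.
Proof.
move=> x0; have [N hN] := lcoef_bound x.
have ex : exists k : nat, lcoef x (N - k%:Z) != 0.
  apply: contrapT => /forallNP h; move/eqP: x0; apply.
  apply: (@laurent_ext _ _ N) => // k; rewrite lcoef0.
  by apply/eqP; rewrite -[_ == _]negbK; apply/negP/h.
case: (ex_minnP ex) => k hk kmin; exists (N - k%:Z); split => // l kl.
have [/hN //|lN] := ltP N l; apply/eqP; rewrite -[_ == _]negbK; apply/negP => h.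
have := kmin (absz (N - l)); rewrite (_ : N - _ = l); last by lia.
by move=> /(_ h); lia.
Qed.

(* First n coefficients, in reverse order, of the power series inverse of a. *)
Let invrev (a : nat -> K) := fix loop (n : nat) : seq K :=
  if n is n'.+1 then
    let s := loop n' in
    (if n' is 0%N then (a 0%N)^-1
     else - (a 0%N)^-1 * \sum_(i < n') a i.+1 * s`_i) :: s
  else [::].

Lemma pseries_inv (a : nat -> K) : a 0%N != 0 -> exists b : nat -> K,
  forall k, \sum_(i < k.+1) a i * b (k - i)%N = (k == 0)%:R.
Proof.
move=> a0; exists (fun k => (invrev a k.+1)`_0).
have nthE n i : (i < n)%N ->
    (invrev a n)`_i = (invrev a (n - i.+1).+1)`_0.
  elim: n i => // n IH [|i] hi; first by rewrite subn1.
  by rewrite subSS -(IH i).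
case=> [|k]; first by rewrite big_ord1 /= divff.
pose S := \sum_(i < k.+1) a i.+1 * (invrev a k.+1)`_i.
have E : (invrev a k.+2)`_0 = - (a 0%N)^-1 * S by [].
rewrite big_ord_recl subn0 E mulrA mulrN divff// mulN1r.
rewrite [X in _ + X](_ : _ = S) ?addNr//.
by apply: eq_bigr => i _; rewrite [in RHS]nthE ?ltn_ord.

Qed.

Lemma laurent_inv_ex x : x != 0 -> exists y, y * x = 1.
Proof.
move=> /laurent_lead[N [xN hx]].
have [|b hb] := @pseries_inv (fun k => lcoef x (N - k%:Z)).
  by rewrite subr0.
pose c l := if l <= - N then b (absz (- N - l)) else 0.
have cb : exists M : int, forall l, M < l -> c l = 0.
  by exists (- N) => l; rewrite /c ltNge => /negbTE ->.
exists (Laurent cb); rewrite mulrC.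
have hc : lbound (Laurent cb) (- N).
  by move=> l; rewrite /= /c ltNge => /negbTE ->.
have h := lbound_mul hx hc; rewrite subrr in h.
apply: (laurent_ext h lbound_one) => k.
rewrite -[0 in LHS](subrr N) /= lconvE//=.
rewrite (_ : _ - _ == 0 = (k == 0)%N); last by lia.
transitivity ((k == 0)%:R : K); last by case: eqP.
rewrite -hb; apply: eq_bigr => i _; congr (_ * _).
by rewrite /c ifT; [congr b|]; lia.
Qed.

Definition linv x : F :=
  if pselect (exists y, y * x = 1) is left h then projT1 (cid h) else 0.

Fact lmulV x : x != 0 -> linv x * x = 1.
Proof.
rewrite /linv => /laurent_inv_ex h; case: pselect => // {}h.
by case: (cid h).
Qed.
Fact linv0 : linv 0 = 0.
Proof.
rewrite /linv; case: pselect => // h.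
by case: (cid h) => y /= /eqP; rewrite mulr0 eq_sym oner_eq0.
Qed.

HB.instance Definition _ := GRing.ComNzRing_isField.Build F lmulV linv0.

(* The inclusion K[X] -> K((X^-1)). *)
Fact lpoly_bound (p : {poly K}) : exists N : int, forall l, N < l ->
  (if 0 <= l then p`_(absz l) else 0) = 0.
Proof.
exists (size p)%:Z => -[n|n] //=; rewrite ltz_nat => /ltnW pn.
by rewrite nth_default.
Qed.
Definition lpoly (p : {poly K}) : F := Laurent (lpoly_bound p).

Lemma lbound_lpoly (p : {poly K}) : lbound (lpoly p) (size p)%:Z.
Proof.
move=> -[n|n] //=; rewrite ltz_nat => /ltnW pn.
by rewrite nth_default.
Qed.

Fact lpoly_is_zmod_morphism : zmod_morphism lpoly.
Proof.
move=> p q; apply: laurentP => l; rewrite lcoefB /=.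
by case: ifP; rewrite ?coefB ?subr0.
Qed.

Fact lpoly_is_monoid_morphism : monoid_morphism lpoly.
Proof.
split=> [|p q]; apply: laurentP => l.
  rewrite lcoef1 /= coef1; case: l => [[|n]|n] //=.
case: l => n; rewrite lcoefM /=; last first.
  rewrite fsbig1// => i _; have [i0|i0] := leP 0 i; last by rewrite mul0r.
  by rewrite ifF ?mulr0//; lia.
rewrite coefM (fsbigE [seq i%:Z | i <- iota 0 n.+1]).
- rewrite [RHS]big_mkcond big_map -/(index_iota 0 n.+1) big_mkord.
  apply: eq_bigr => i _; rewrite in_setT /= ifT; last first.
    by have := ltn_ord i; lia.
  by congr (_ * q`_ _); have := ltn_ord i; lia.
- by rewrite map_inj_uniq ?iota_uniq// => i j [].
- by [].
- move=> i _ /mapP hi; have [i0|i0] := leP 0 i; last by rewrite mul0r.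
  rewrite ifF ?mulr0//; apply/negP => il; apply: hi.
  by exists (absz i); [rewrite mem_iota|]; lia.
Qed.

HB.instance Definition _ :=
  GRing.isZmodMorphism.Build {poly K} F lpoly lpoly_is_zmod_morphism.
HB.instance Definition _ :=
  GRing.isMonoidMorphism.Build {poly K} F lpoly lpoly_is_monoid_morphism.

(* [ldeg x] is the exponent of the leading term of [x] when [x != 0]. *)
Definition ldeg x : int :=
  xget 0 [set l | lcoef x l != 0 /\ forall k, l < k -> lcoef x k = 0].

Lemma ldegP x : x != 0 ->
  lcoef x (ldeg x) != 0 /\ forall k, ldeg x < k -> lcoef x k = 0.
Proof. by move=> /laurent_lead h; exact: (xgetPex 0 h). Qed.

(* The uniformity of the absolute value, stated without the reals: x and y are
   close when their coefficients agree from some negative index N upwards. *)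
Definition lent : set_system (F * F) :=
  filter_from [set: int]
    (fun N => [set xy | forall l, N <= l -> lcoef xy.1 l = lcoef xy.2 l]).

Fact lent_filter : Filter lent.
Proof.
apply: filter_from_filter => [|N M _ _]; first by exists 0.
exists (Num.min N M) => // -[x y] /= h.
by split => l hl; apply: h; rewrite ge_min hl ?orbT.
Qed.
Fact lent_diagonal A : lent A -> diagonal `<=` A.
Proof.
move=> [N _ NA] -[x y] xy; apply: NA => l _.
by rewrite [x]xy.
Qed.
Fact lent_inv A : lent A -> lent A^-1%relation.
Proof.
by move=> [N _ NA]; exists N => // -[x y] /= h; apply: NA => l /= /h.
Qed.
Fact lent_split A : lent A -> exists2 B, lent B & (B \; B `<=` A)%relation.
Proof.
move=> [N _ NA].
exists [set xy | forall l, N <= l -> lcoef xy.1 l = lcoef xy.2 l].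
  by exists N.
move=> -[x y] /= [z /= xz zy]; apply: NA => l /= Nl.
by rewrite xz// zy.
Qed.

HB.instance Definition _ :=
  isUniform.Build F lent_filter lent_diagonal lent_inv lent_split.

End LaurentField.

Section AbsoluteValue.
Variables (R : realType) (K : fieldType).
Local Notation F := (laurent K).
Implicit Types (x y z : F) (l N : int).

Definition labs x : R := if x == 0 then 0 else expR (ldeg x)%:~R.

Lemma labs0 : labs 0 = 0. Proof. by rewrite /labs eqxx. Qed.

Lemma labs_ge0 x : 0 <= labs x.
Proof. by rewrite /labs; case: ifP => // _; exact: expR_ge0. Qed.

Lemma labs_coef x l : lcoef x l != 0 -> expR l%:~R <= labs x.
Proof.
move=> xl; rewrite /labs ifF; last first.
  by apply/negbTE; apply: contraNneq xl => ->.
have /ldegP[_ h] : x != 0 by apply: contraNneq xl => ->.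
rewrite ler_expR ler_int leNgt; apply/negP => /h /eqP.
by rewrite (negbTE xl).
Qed.

Lemma labsP x : x != 0 -> exists2 l, lcoef x l != 0 & labs x = expR l%:~R.
Proof.
by move=> x0; exists (ldeg x); [case: (ldegP x0)|rewrite /labs (negbTE x0)].
Qed.

Lemma labs_lt x N :
  (labs x < expR N%:~R) <-> (forall l, N <= l -> lcoef x l = 0).
Proof.
split=> [xN l Nl|h].
  apply/eqP; rewrite -[_ == _]negbK; apply/negP => /labs_coef.
  move=> /le_lt_trans/(_ xN); rewrite ltr_expR ltr_int; lia.
have [->|/labsP[l xl ->]] := eqVneq x 0; first by rewrite labs0 expR_gt0.
rewrite ltr_expR ltr_int ltNge; apply/negP => /h /eqP.
by rewrite (negbTE xl).
Qed.

Lemma labsN x : labs (- x) = labs x.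
Proof.
rewrite /labs oppr_eq0; congr (if _ then _ else expR _%:~R).
have E l : (lcoef (- x) l == 0) = (lcoef x l == 0) by rewrite lcoefN oppr_eq0.
rewrite /ldeg; congr xget; apply/seteqP; split=> l /= [h1 h2]; split.
- by rewrite -E.
- by move=> k /h2 /eqP; rewrite E => /eqP.
- by rewrite E.
- by move=> k /h2 /eqP; rewrite -E => /eqP.
Qed.

Lemma labsD x y : labs (x + y) <= Num.max (labs x) (labs y).
Proof.
have [->|/labsP[l + ->]] := eqVneq (x + y) 0.
  by rewrite labs0 le_max labs_ge0.
rewrite lcoefD le_max; have [->|/labs_coef ->//] := eqVneq (lcoef x l) 0.
by rewrite add0r => /labs_coef ->; rewrite orbT.
Qed.

Definition lball x (e : R) y : Prop := labs (x - y) < e.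

Fact lball_center x (e : R) : 0 < e -> lball x e x.
Proof. by rewrite /lball subrr labs0. Qed.
Fact lball_sym x y (e : R) : lball x e y -> lball y e x.
Proof. by rewrite /lball -labsN opprB. Qed.
Fact lball_triangle x y z (e1 e2 : R) :
  lball x e1 y -> lball y e2 z -> lball x (e1 + e2) z.
Proof.
rewrite /lball => xy yz; rewrite -(subrKA y).
have e10 := le_lt_trans (labs_ge0 _) xy; have e20 := le_lt_trans (labs_ge0 _) yz.
apply: le_lt_trans (labsD _ _) _; rewrite gt_max.
rewrite (lt_trans xy) ?ltrDl//.
by rewrite (lt_trans yz) ?ltrDr.
Qed.
Fact lball_entourage : entourage = entourage_ lball.
Proof.
rewrite predeqE => A; split=> [[N _ NA]|[e /= e0 eA]].
  exists (expR N%:~R) => /=; first exact: expR_gt0.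
  move=> -[x y] /= /labs_lt h; apply: NA => l /= /h /eqP.
  by rewrite lcoefB subr_eq0 => /eqP.
exists (Num.floor (ln e)) => // -[x y] /= h; apply: eA => /=.
apply: (@lt_le_trans _ _ (expR (Num.floor (ln e))%:~R)).
  by apply/labs_lt => l /h hl; rewrite lcoefB hl subrr.
by rewrite -[leRHS]lnK ?posrE// ler_expR floor_le.
Qed.

HB.instance Definition _ := Uniform_isPseudoMetric.Build R F
  lball_center lball_sym lball_triangle lball_entourage.

Definition supnorm m n (A : 'M[F]_(m, n)) : R :=
  \big[Num.max/0]_(ij : 'I_m * 'I_n) labs (A ij.1 ij.2).

(* The balls that the library puts on matrices are the sup norm balls. *)
Lemma mx_ball_supnorm m n (A B : 'M[F]_(m, n)) (e : R) :
  ball A e B <-> supnorm (A - B) < e.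
Proof.
split=> [[e0 h]|h].
  apply: bigmax_lt => // -[i j] _; rewrite !mxE; exact: h.
have /bigmax_ltP[e0 {}h] := h.
by split=> // i j; have := h (i, j) isT; rewrite !mxE.
Qed.

End AbsoluteValue.

HB.instance Definition _ (K : fieldType) := isPointed.Build (laurent K) 0.

Notation matF K m n := 'M[laurent K]_(m, n).

(* F^{m x n} with its Borel sigma-algebra. *)
Notation borelF K m n := (g_sigma_algebraType (@open (matF K m n))).

Section Exponents.
Variables (R : realType) (K : fieldType) (m n : nat).
Local Notation F := (laurent K).

Definition prodabs k (y : 'cV[F]_k) : R := \prod_(j < k) labs R (y j 0).

Definition prodabs_plus k (q : 'cV[{poly K}]_k) : R :=
  \prod_(i < k) Num.max 1 (labs R (lpoly (q i 0))).

(* Y q + p + theta, with p and q polynomial vectors. *)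
Definition lform (Y : 'M[F]_(m, n)) (theta : 'cV[F]_m)
    (p : 'cV[{poly K}]_m) (q : 'cV[{poly K}]_n) : 'cV[F]_m :=
  Y *m map_mx (@lpoly K) q + map_mx (@lpoly K) p + theta.

(* The exponents are suprema in the extended reals: they may be infinite. *)
Definition omega (Y : 'M[F]_(m, n)) (theta : 'cV[F]_m) : \bar R :=
  ereal_sup [set w%:E | w in [set w : R | 0 <= w /\
    forall T0 : R, exists2 T : R, T0 <= T & 1 <= T /\
      exists (p : 'cV[{poly K}]_m) (q : 'cV[{poly K}]_n),
        [/\ q != 0,
            supnorm R (lform Y theta p q) ^+ m < expR (- (w * T)) &
            supnorm R (map_mx (@lpoly K) q) ^+ n < expR T]]].

Definition omega_mul (Y : 'M[F]_(m, n)) (theta : 'cV[F]_m) : \bar R :=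
  ereal_sup [set w%:E | w in [set w : R | 0 <= w /\
    forall T0 : R, exists2 T : R, T0 <= T & 1 <= T /\
      exists (p : 'cV[{poly K}]_m) (q : 'cV[{poly K}]_n),
        [/\ q != 0,
            prodabs (lform Y theta p q) < expR (- (w * T)) &
            prodabs_plus q < expR T]]].

End Exponents.

Section Contracting.
Variables (R : realType) (K : fieldType) (m n : nat).
Local Notation F := (laurent K).
Local Notation M := (matF K m n).
Implicit Types mu : {measure set (borelF K m n) -> \bar R}.

(* For finite K the space F^{m x n} is second countable, so this intersection
   is itself closed and of full measure: it is the smallest such set. *)
Definition support mu : set M :=
  \bigcap_(C in [set C : set M | closed C /\ mu (~` C) = 0%E]) C.

Definition non_atomic mu : Prop := forall Y : M, mu [set Y] = 0%E.

(* A ball is given by its centre and radius, which the underlying set does not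
   determine; its dilate by a is the ball with a times the radius. *)
Definition doubling mu : Prop :=
  exists2 c : R, 0 < c & forall (Y : M) (r : R), support mu Y -> 0 < r ->
    (mu (ball Y (2 * r)) <= c%:E * mu (ball Y r))%E.

Definition slab (b : 'cV[F]_n) (c : 'cV[F]_m) (eps : 'I_m -> R) : set M :=
  [set Y | forall i, labs R ((Y *m b + c) i 0) < eps i].

(* The contraction condition for those eps that satisfy P; the inequality
   eps j < r0 for some j says that the least entry of eps is less than r0. *)
Definition contracts (P : set ('I_m -> R)) mu : Prop :=
  exists C alpha r0 : R, [/\ 0 < C, 0 < alpha, 0 < r0 &
    forall (b : 'cV[F]_n) (c : 'cV[F]_m) (eps : 'I_m -> R) (delta : R),
      supnorm R b = 1 -> (forall i, 0 < eps i) -> P eps ->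
      (exists j, eps j < r0) -> 0 < delta < 1 ->
      forall Y : M, slab b c (fun i => delta * eps i) Y -> support mu Y ->
      exists r : R, [/\ 0 < r,
        ball Y r `&` support mu `<=` slab b c eps &
        (mu (ball Y (5 * r) `&` slab b c (fun i => delta * eps i)%R) <=
           (C * delta `^ alpha)%:E * mu (ball Y (5 * r)))%E]].

Definition strongly_contracting mu : Prop :=
  [/\ (mu setT < +oo)%E, non_atomic mu, doubling mu & contracts setT mu].

Definition contracting mu : Prop :=
  [/\ (mu setT < +oo)%E, non_atomic mu, doubling mu &
      contracts [set eps | forall i j, eps i = eps j] mu].

(* The restriction of mu to V needs V to be Borel. *)
Definition almost_everywhere_locally
    (Q : {measure set (borelF K m n) -> \bar R} -> Prop) mu : Prop :=
  {ae mu, forall Y0 : borelF K m n,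
    exists (V : set (borelF K m n)) (mV : measurable V),
      nbhs (Y0 : M) (V : set M) /\ Q (mrestr mu mV)}.

Definition strongly_contracting_ae mu : Prop :=
  almost_everywhere_locally strongly_contracting mu.

Definition contracting_ae mu : Prop :=
  almost_everywhere_locally contracting mu.

End Contracting.

(* Main.v *)
Require Import Defs.
From mathcomp Require Import zify ring lra.

(** Two distinct inhomogeneous solutions (p, q), (p', q') of the same height
    differ by a homogeneous one, and the ultrametric inequality makes this
    lossless: where their slabs meet, the point lies in a homogeneous
    approximation set of that height. The limsup of these sets is null, so
    outside a set of small measure the slabs of a given height are disjoint.
    Contraction says that, cell by cell, shrinking a slab by delta costs a factor
    delta^alpha; disjointness lets one sum this over all slabs of a given height,
    and with delta exponentially small in the height Borel-Cantelli applies.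
    Cells more than half covered by homogeneous sets do not allow the summation,
    but since cells are nested or disjoint, the union of all of them, over all
    large heights at once, has at most twice the measure of the homogeneous part;
    no density theorem is needed. In the multiplicative case the hyperbolic
    regions are first cut into boxes, polynomially many in the height. *)

Set Implicit Arguments.
Unset Strict Implicit.
Unset Printing Implicit Defensive.

Import Order.TTheory GRing.Theory Num.Theory.

(** * Nested countable partitions *)

(** The fibres of [tr k] form the partition of level k, coarser as k grows. In the application
    [tr k] forgets the coefficients below X^k, and the cells are the balls of radius e^k. *)
Definition cell (T C : Type) (tr : int -> T -> C) k x : set T :=
  [set y | tr k y = tr k x].

Section NestedPartitions.
Context d (T : measurableType d) (R : realType) (C : countType).
Variables (tr : int -> T -> C) (nu : {measure set T -> \bar R}).
Hypothesis tr_coarsen :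
  forall k l x y, k <= l -> tr k x = tr k y -> tr l x = tr l y.
Hypothesis tr_measurable : forall k (A : set C), measurable (tr k @^-1` A).
Implicit Types (P Q U : set T) (kap : R).

Lemma measurable_cell k x : measurable (cell tr k x).
Proof. exact: (tr_measurable k [set tr k x]). Qed.

Lemma measure_bigcup_le (F : (set T)^nat) P Q kap :
  0 <= kap -> measurable P -> measurable Q ->
  (forall i, measurable (F i)) -> trivIset setT F ->
  (forall i, (nu (F i `&` P) <= kap%:E * nu (F i `&` Q))%E) ->
  (nu ((\bigcup_i F i) `&` P) <= kap%:E * nu ((\bigcup_i F i) `&` Q))%E.
Proof.
move=> kap0 mP mQ mF tF h.
have E B : measurable B ->
    nu ((\bigcup_i F i) `&` B) = (\sum_(i <oo) nu (F i `&` B))%E.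
  move=> mB; rewrite setI_bigcupl measure_bigcup//=.
  - by apply: eq_eseriesl => i; rewrite in_setT.
  - by move=> i _; exact: measurableI.
  - exact: trivIset_setIr.
rewrite !E// -nneseriesZl//; exact: lee_nneseries.
Qed.

Lemma level_union_le k (A : set C) P Q kap :
  0 <= kap -> measurable P -> measurable Q ->
  (forall x, A (tr k x) ->
     (nu (cell tr k x `&` P) <= kap%:E * nu (cell tr k x `&` Q))%E) ->
  (nu (tr k @^-1` A `&` P) <= kap%:E * nu (tr k @^-1` A `&` Q))%E.
Proof.
move=> kap0 mP mQ h.
pose F i := tr k @^-1` (A `&` [set c | pickle c = i]).
have -> : tr k @^-1` A = \bigcup_i F i.
  apply/seteqP; split=> [x Ax|x [i _ []]//].
  by exists (pickle (tr k x)).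
apply: measure_bigcup_le => // [i|i|i]; first exact: tr_measurable.
  by move=> j _ _ [x [[/= _ <-] [/= _ <-]]].
have [->|/set0P[x [Ax /= xi]]] := eqVneq (F i) set0.
  by rewrite !set0I measure0 mule0.
rewrite (_ : F i = cell tr k x); first exact: h.
apply/seteqP; split=> y; rewrite /F /cell /=.
  by move=> [_ yi]; apply: (pcan_inj pickleK); rewrite yi.
by move=> ->.
Qed.

Definition cell_union (A : int -> set C) : set T := \bigcup_k (tr k @^-1` A k).

Lemma measurable_cell_union A : measurable (cell_union A).
Proof.
pose F (i : nat) := tr i%:Z @^-1` A i%:Z `|` tr (- i%:Z) @^-1` A (- i%:Z).
rewrite (_ : cell_union A = \bigcup_i F i).
  by apply: bigcupT_measurable => i; apply: measurableU; exact: tr_measurable.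
apply/seteqP; split=> [x [[i|i] _ h]|x [i _ [h|h]]].
- by exists i => //; left.
- by exists i.+1 => //; right; rewrite -NegzE.
- by exists i%:Z.
- by exists (- i%:Z).
Qed.

(* The cells of a nested sequence of partitions are pairwise nested or
   disjoint, so a union of cells is a disjoint union of maximal ones; this
   replaces the 5r-covering lemma. Levels are bounded first, so that maximal
   cells exist, and the bound is then sent to infinity. *)
Lemma cell_union_le (A : int -> set C) P Q kap :
  0 <= kap -> measurable P -> measurable Q ->
  (forall k x, A k (tr k x) ->
     (nu (cell tr k x `&` P) <= kap%:E * nu (cell tr k x `&` Q))%E) ->
  (nu (cell_union A `&` P) <= kap%:E * nu (cell_union A `&` Q))%E.
Proof.
move=> kap0 mP mQ h.
pose U (J : nat) := \bigcup_(i : nat) (tr (J%:Z - i%:Z) @^-1` A (J%:Z - i%:Z)).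
have mU J : measurable (U J).
  by apply: bigcupT_measurable => i; exact: tr_measurable.
have UE : cell_union A = \bigcup_J U J.
  apply/seteqP; split=> [x [k _ Ak]|x [J _ [i _ Ai]]].
    exists `|k|%N => //; exists (absz (`|k|%N%:Z - k)) => //=.
    by rewrite (_ : _ - _ = k)//; lia.
  by exists (J%:Z - i%:Z).
have Ule J : (nu (U J `&` P) <= kap%:E * nu (U J `&` Q))%E.
  (* [B i] labels the maximal cells of level J - i: no cell above them, at the levels J - j with j <
     i, is selected. *)
  pose B i := A (J%:Z - i%:Z) `&` [set c | forall x, tr (J%:Z - i%:Z) x = c ->
     forall j, (j < i)%N -> ~ A (J%:Z - j%:Z) (tr (J%:Z - j%:Z) x)].
  have -> : U J = \bigcup_i (tr (J%:Z - i%:Z) @^-1` B i).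
    apply/seteqP; split=> [x [i _ Ai]|x [i _ [Ai _]]]; last by exists i.
    have ex : exists i, `[< A (J%:Z - i%:Z) (tr (J%:Z - i%:Z) x) >].
      by exists i; apply/asboolP.
    case: (ex_minnP ex) => {Ai}i /asboolP Ai imin; exists i => //; split=> //.
    move=> y /= yx j ji Aj; suff : (i <= j)%N by rewrite leqNgt ji.
    apply: imin; apply/asboolP; rewrite -(@tr_coarsen (J%:Z - i%:Z) _ y x)//.
    by lia.
  apply: measure_bigcup_le => // [i j _ _|i].
    wlog ij : i j / (i <= j)%N.
      move=> H; have [|/ltnW] := leqP i j; first exact: H.
      by move=> ji xx; apply/esym; apply: H => //; rewrite setIC.
    move=> [x [/= [Ai _] [_ /(_ x erefl i)]]].
    by rewrite leq_eqVlt in ij; case/orP: ij => [/eqP//|-> /(_ isT)].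
  by apply: level_union_le => // x [Ax _]; exact: h.
have UP : (fun J => nu (U J `&` P)) @ \oo --> nu ((\bigcup_J U J) `&` P).
  rewrite setI_bigcupl; apply: nondecreasing_cvg_mu.
  - by move=> J; exact: measurableI.
  - by apply: bigcupT_measurable => J; exact: measurableI.
  - move=> I J IJ; apply/subsetPset; apply: setSI => x [i _ Ai].
    exists (J - I + i)%N => //=; rewrite (_ : _ - _ = I%:Z - i%:Z)//.
    by lia.
have mV : measurable (\bigcup_J U J) by exact: bigcupT_measurable.
rewrite UE -(cvg_lim _ UP)//; apply: lime_le; first by apply/cvg_ex; eexists; exact: UP.
apply: nearW => J; apply: le_trans (Ule J) _; apply: lee_pmul => //.
by apply: le_measure; rewrite ?inE; [exact: measurableI..|];
  apply: setSI; exact: bigcup_sup.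
Qed.

Lemma cell_union_null (A : int -> set C) P :
  measurable P -> (forall k x, A k (tr k x) -> nu (cell tr k x `&` P) = 0%E) ->
  nu (cell_union A `&` P) = 0%E.
Proof.
move=> mP h; apply/eqP; rewrite -measure_le0.
rewrite -(mul0e (nu (cell_union A `&` P))).
by apply: cell_union_le => // k x /h ->; rewrite mul0e.
Qed.

End NestedPartitions.

(** * The abstract transference *)

Lemma measurable_lim_sup_set d (T : measurableType d) (F : (set T)^nat) :
  (forall i, measurable (F i)) -> measurable (lim_sup_set F).
Proof.
by move=> mF; apply: bigcapT_measurable => i; apply: bigcup_measurable.
Qed.

Lemma bigcup_countType T (I : countType) (F : I -> set T) :
  \bigcup_i F i = \bigcup_(k : nat) (if pickle_inv k is Some i then F i else set0).
Proof.
apply/seteqP; split=> [x [i _ Fi]|x [k _]].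
  by exists (pickle i) => //; rewrite pickleK_inv.
by case: pickle_inv => // i Fi; exists i.
Qed.

Lemma measurable_bigcup_countType d (T : measurableType d) (I : countType)
    (F : I -> set T) : (forall i, measurable (F i)) -> measurable (\bigcup_i F i).
Proof.
move=> mF; rewrite bigcup_countType; apply: bigcupT_measurable => k.
by case: pickle_inv.
Qed.

Lemma measure_bigcup_finType d (T : measurableType d) (R : realType)
    (nu : {measure set T -> \bar R}) (I : finType) (F : I -> set T) (r : \bar R) :
  (forall i, measurable (F i)) -> (forall i, (nu (F i) <= r)%E) ->
  (nu (\bigcup_i F i) <= #|I|%:R%:E * r)%E.
Proof.
move=> mF Fr; rewrite (_ : \bigcup_i F i = \big[setU/set0]_(i <- enum I) F i).
  rewrite cardE; elim: (enum I) => [|i s IH].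
    by rewrite big_nil measure0 mul0e.
  rewrite big_cons /= (le_trans (measureU2 _ _ _))//.
    exact: bigsetU_measurable.
  by rewrite -natr1 EFinD ge0_muleDl ?lee_fin ?ler0n// mul1e addeC (leeD IH (Fr i)).
rewrite -bigcup_seq (_ : [set` enum I] = setT)//.
by apply/seteqP; split=> // i _ /=; exact: mem_enum.
Qed.

Section Transference.
Context d (T : measurableType d) (R : realType) (C : countType).
Variables (tr : int -> T -> C) (nu : {measure set T -> \bar R}).
Hypothesis tr_coarsen :
  forall k l x y, k <= l -> tr k x = tr k y -> tr l x = tr l y.
Hypothesis tr_measurable : forall k (A : set C), measurable (tr k @^-1` A).
Hypothesis nu_fin : (nu setT < +oo)%E.

Section OneLevel.
Variables (I : countType) (L l : I -> set T) (G : set T) (kap : R).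
Hypotheses (kap0 : 0 <= kap) (mG : measurable G).
Hypotheses (mL : forall a, measurable (L a)) (ml : forall a, measurable (l a)).
Hypothesis disj : forall a b x, a <> b -> L a x -> L b x -> ~ G x.

(** Containment in [L a] is asked up to a null set, since contraction controls a ball only on the
    support. [G] will be the complement of the homogeneous sets, so the last clause excludes cells
    more than half covered by them. *)
Definition good a k : set C := [set c | exists x, [/\ tr k x = c,
  nu (cell tr k x `\` L a) = 0%E,
  (nu (cell tr k x `&` l a) <= kap%:E * nu (cell tr k x))%E
  & (nu (cell tr k x) <= 2%:E * nu (cell tr k x `&` G))%E]].

Definition good_part : set T :=
  \bigcup_a (cell_union tr (good a) `&` l a).

Lemma measurable_good_part : measurable good_part.
Proof.
apply: measurable_bigcup_countType => a; apply: measurableI => //.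
exact: measurable_cell_union.
Qed.

(** A good cell meets [l a] in measure at most kap times its own, hence at most 2 kap times that of
    its part in [L a] and [G]. Maximal cells carry this over to the union of the good cells of a; as
    the sets [L a] are disjoint on [G], summing over a costs no more than the total mass. *)
Lemma good_part_le : (nu good_part <= (kap * 2)%:E * nu setT)%E.
Proof.
have k20 : 0 <= kap * 2 by rewrite mulr_ge0.
have one a : (nu (cell_union tr (good a) `&` l a) <=
    (kap * 2)%:E * nu (L a `&` G))%E.
  apply: (@le_trans _ _ ((kap * 2)%:E * nu (cell_union tr (good a) `&` (L a `&` G)))%E).
    apply: cell_union_le => //; first exact: measurableI.
    move=> k x [y [yx n0 nl nG]]; rewrite /cell -yx -/(cell tr k y).
    have mc : measurable (cell tr k y) by exact: measurable_cell.
    apply: le_trans nl _; rewrite EFinM -muleA; apply: lee_pmul => //.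
    apply: le_trans nG _; apply: lee_pmul => //.
    rewrite [leLHS](@measureDI _ _ _ _ _ (L a)) //; last exact: measurableI.
    rewrite [X in (X + _ <= _)%E](_ : _ = 0%E) ?add0e.
      by rewrite -setIA (setIC G).
    apply/eqP; rewrite -measure_le0 -n0; apply: le_measure; rewrite ?inE.
    - by apply: measurableD => //; exact: measurableI.
    - exact: measurableD.
    - by move=> z [[]].
  apply: lee_pmul => //; apply: le_measure; rewrite ?inE//.
  - by apply: measurableI; [exact: measurable_cell_union|exact: measurableI].
  - exact: measurableI.
pose F k := if pickle_inv k is Some a then cell_union tr (good a) `&` l a else set0.
pose E k := if pickle_inv k is Some a then L a `&` G else set0.
have mF k : measurable (F k).
  rewrite /F; case: pickle_inv => // a; apply: measurableI => //.
  exact: measurable_cell_union.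
have mE k : measurable (E k).
  by rewrite /E; case: pickle_inv => // a; exact: measurableI.
rewrite /good_part bigcup_countType -/F.
apply: (@le_trans _ _ (\sum_(k <oo) nu (F k))%E).
  by apply: measure_sigma_subadditive => //; exact: bigcupT_measurable.
apply: (@le_trans _ _ (\sum_(k <oo) ((kap * 2)%:E * nu (E k)))%E).
  apply: lee_nneseries => // k _; rewrite /F /E; case: pickle_inv => [a|].
    exact: one.
  by rewrite measure0 mule0.
rewrite nneseriesZl//; apply: lee_pmul => //; first exact: nneseries_ge0.
rewrite -measure_semi_bigcup//.
- by apply: le_measure; rewrite ?inE//; exact: bigcupT_measurable.
- move=> i j _ _ [x []]; rewrite /E.
  have := @pickle_invK I i; have := @pickle_invK I j.
  case: (pickle_inv i) => [a|//]; case: (pickle_inv j) => [b|//] /= bj ai.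
  move=> [La Gx] [Lb _]; rewrite -ai -bj; congr pickle; apply: contrapT => ab.
  exact: (disj ab La Lb).
- exact: bigcupT_measurable.
Qed.
End OneLevel.

(** [B N] lists the box shapes at height N. Slabs are disjoint only within one shape, so each shape
    costs up to 2 kap N times the total mass, and the summability hypothesis is the one that
    Borel-Cantelli asks for. *)
Theorem transference (H : (set T)^nat) (S : set T) (B : nat -> finType)
    (I : countType) (L l : forall N, B N -> I -> set T) (kap : R^nat) (N0 : nat) :
  (forall N, measurable (H N)) -> nu (lim_sup_set H) = 0%E ->
  measurable S -> nu (~` S) = 0%E ->
  (forall N t a, measurable (L N t a)) -> (forall N t a, measurable (l N t a)) ->
  (forall N, 0 <= kap N) ->
  (\sum_(N <oo) (#|B N|%:R * kap N)%:E < +oo)%E ->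
  (forall N t a b x, (N0 <= N)%N -> a <> b -> L N t a x -> L N t b x -> H N x) ->
  (forall N t a x, (N0 <= N)%N -> l N t a x -> S x -> exists k,
     cell tr k x `&` S `<=` L N t a /\
     (nu (cell tr k x `&` l N t a) <= (kap N)%:E * nu (cell tr k x))%E) ->
  nu (lim_sup_set (fun N => \bigcup_t \bigcup_a l N t a)) = 0%E.
Proof.
move=> mH H0 mS S0 mL ml kap0 skap disj cov.
set E := fun N => _; have mE N : measurable (E N).
  by apply: measurable_bigcup_countType => t; exact: measurable_bigcup_countType.
pose X M := \bigcup_(N >= M) H N.
have mX M : measurable (X M) by exact: bigcup_measurable.
(* The sets [X M] decrease to the limsup of [H], so their measures tend to 0 because [nu] is
   finite. *)
suff key M : (N0 <= M)%N -> (nu (lim_sup_set E) <= 2%:E * nu (X M))%E.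
  have := lim_sup_set_cvg nu H mH; rewrite H0 => cX.
  have {}cX : nu (X M) @[M --> \oo] --> 0%E.
    apply: cX; apply: le_lt_trans nu_fin.
    by apply: le_measure; rewrite ?inE//; exact: mX.
  have {}cX : (2%:E * nu (X M))%E @[M --> \oo] --> (2%:E * 0)%E.
    by apply: cvgeZl.
  rewrite mule0 in cX; apply/eqP; rewrite -measure_le0 -(cvg_lim _ cX)//.
  apply: lime_ge; first by apply/cvg_ex; eexists; exact: cX.
  by exists N0.
move=> N0M; pose G := ~` X M.
have mG : measurable G by exact: measurableC.
(* A bad cell has more than half of its mass in [X M]. The union runs over all levels, so its bound
   is paid once and not for each height. *)
pose bad k : set C := [set c | exists2 x, tr k x = c &
  (2%:E * nu (cell tr k x `&` G) < nu (cell tr k x))%E].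
have bad_le : (nu (cell_union tr bad) <= 2%:E * nu (X M))%E.
  rewrite -[X in nu X]setIT.
  apply: (@le_trans _ _ (2%:E * nu (cell_union tr bad `&` X M))%E).
    apply: cell_union_le => // k x [y yx lt2]; rewrite /cell -yx -/(cell tr k y).
    have mc : measurable (cell tr k y) by exact: measurable_cell.
    rewrite setIT; move: lt2.
    have : nu (cell tr k y) = (nu (cell tr k y `&` G) + nu (cell tr k y `&` X M))%E.
      by rewrite (@measureDI _ _ _ nu _ _ mc (mX M)) setDE.
    have fin Z : measurable Z -> nu Z \is a fin_num.
      move=> mZ; rewrite ge0_fin_numE//; apply: le_lt_trans nu_fin.
      by apply: le_measure; rewrite ?inE.
    have /fineK <- := fin _ (measurableI _ _ mc mG).
    have /fineK <- := fin _ (measurableI _ _ mc (mX M)).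
    by move=> ->; rewrite -!EFinM -EFinD lte_fin lee_fin; lra.
  apply: lee_pmul => //; apply: le_measure; rewrite ?inE//.
  by apply: measurableI => //; exact: measurable_cell_union.
(* For N >= M the set [H N] lies in [X M], so on [G] the slabs of one shape are disjoint. *)
pose W N := if (N < M)%N then set0 else
  \bigcup_t good_part (L N t) (l N t) G (kap N).
have mW N : measurable (W N).
  rewrite /W; case: ifP => // _; apply: measurable_bigcup_countType => t.
  exact: measurable_good_part.
have W0 : nu (lim_sup_set W) = 0%E.
  apply: lim_sup_set_cvg0 => //.
  apply: (@le_lt_trans _ _ (\sum_(N <oo) ((2 * fine (nu setT))%:E *
      (#|B N|%:R * kap N)%:E))%E).
    apply: lee_nneseries => // N _; rewrite /W; case: ltnP => MN.
      by rewrite measure0 -EFinM lee_fin !mulr_ge0// fine_ge0.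
    have W1 t : (nu (good_part (L N t) (l N t) G (kap N)) <=
        (kap N * 2)%:E * nu setT)%E.
      apply: good_part_le => // a b x ab La Lb; apply; exists N => //.
      by apply: (disj N t a b) => //; exact: leq_trans MN.
    apply: le_trans (measure_bigcup_finType _ W1) _.
      by move=> t; exact: measurable_good_part.
    have /fineK <- : nu setT \is a fin_num by rewrite ge0_fin_numE.
    by rewrite -!EFinM lee_fin /=; lra.
  rewrite nneseriesZl; last by move=> N _; rewrite lee_fin mulr_ge0.
  by rewrite lte_mul_pinfty// lee_fin mulr_ge0// fine_ge0.
have mC : measurable (cell_union tr bad) by exact: measurable_cell_union.
have mlW : measurable (lim_sup_set W) by exact: measurable_lim_sup_set.
(* A point of infinitely many shrunken slabs is outside [S], or in a bad cell, or else the cells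
   given by contraction at heights N >= M are all good and put it in infinitely many [W N]. *)
apply: (@le_trans _ _ (nu (cell_union tr bad `|` (lim_sup_set W `|` ~` S)))).
  apply: le_measure; rewrite ?inE.
  - exact: measurable_lim_sup_set.
  - by apply: measurableU => //; apply: measurableU => //; exact: measurableC.
  move=> x Ex; have [[k _ bk]|nbad] := pselect (cell_union tr bad x).
    by left; exists k.
  right; have [Sx|] := pselect (S x); [left|by right].
  move=> N _; have [N' NN' [t _ [a _ lx]]] := Ex (maxn N M) Logic.I.
  exists N'; first by rewrite /= (leq_trans _ NN')// leq_maxl.
  have MN : (M <= N')%N by rewrite (leq_trans _ NN')// leq_maxr.
  rewrite /W ltnNge MN /=; exists t => //; exists a => //; split=> //.
  have [k [cL cl]] := cov N' t a x (leq_trans N0M MN) lx Sx.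
  exists k => //; exists x; split=> //.
    have mc : measurable (cell tr k x) by exact: measurable_cell.
    apply/eqP; rewrite -measure_le0 -S0; apply: le_measure; rewrite ?inE.
    - exact: measurableD.
    - exact: measurableC.
    - by move=> y [cy nL] Sy; apply: nL; exact: cL.
  rewrite leNgt; apply/negP => h; apply: nbad; exists k => //.
  by exists x.
apply: le_trans (measureU2 _ _ _) _ => //.
  by apply: measurableU => //; exact: measurableC.
rewrite -[leRHS]adde0; apply: leeD => //.
apply: le_trans (measureU2 _ _ _) _ => //; first exact: measurableC.
rewrite -[leRHS]adde0; apply: leeD; rewrite le_eqVlt;
  apply/orP; left; apply/eqP; [exact: W0|exact: S0].
Qed.

End Transference.

(** * Absolute value and truncation in K((X^-1)) *)

Lemma ceil_absz_ge (R : realType) (x : R) : x <= (absz (Num.ceil x))%:R.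
Proof. by apply: le_trans (ceil_ge _) _; rewrite natr_absz ler_int ler_norm. Qed.

Section Laurent.
Variables (R : realType) (K : fieldType).
Local Notation F := (laurent K).
Local Notation labs := (@labs R K).
Implicit Types (x y z : F) (k l : int).

Lemma labs_lbound x k : labs x <= expR k%:~R <-> lbound x k.
Proof.
split=> [xk l kl|xk].
  apply/eqP; rewrite -[_ == _]negbK; apply/negP => /(labs_coef R)/le_trans/(_ xk).
  by rewrite ler_expR ler_int leNgt kl.
have [->|/(labsP R)[l xl ->]] := eqVneq x 0; first by rewrite labs0 expR_ge0.
rewrite ler_expR ler_int leNgt; apply/negP => /xk /eqP.
by rewrite (negbTE xl).
Qed.

Lemma labs_eq0 x : (labs x == 0) = (x == 0).
Proof.
rewrite /Defs.labs; case: ifP => // _; first exact: eqxx.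
by apply/negbTE; rewrite gt_eqF ?expR_gt0.
Qed.

Lemma labsE x : x != 0 -> labs x = expR (ldeg x)%:~R.
Proof. by rewrite /Defs.labs => /negbTE ->. Qed.

Lemma labsM x y : labs (x * y) = labs x * labs y.
Proof.
have [->|x0] := eqVneq x 0; first by rewrite mul0r labs0 mul0r.
have [->|y0] := eqVneq y 0; first by rewrite mulr0 labs0 mulr0.
have [xl hx] := ldegP x0; have [yl hy] := ldegP y0.
rewrite (labsE x0) (labsE y0) -expRD -intrD.
apply/eqP; rewrite eq_le; apply/andP; split.
  by apply/labs_lbound; exact: lbound_mul.
apply: labs_coef; have := lconvE 0 hx hy.
rewrite subr0 /= => ->; rewrite big_ord1 /= !subr0.
by rewrite mulf_neq0.
Qed.

Lemma labs1 : labs 1 = 1.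
Proof.
have /eqP : labs 1 * labs 1 = labs 1 * 1 by rewrite -labsM !mulr1.
by rewrite -subr_eq0 -mulrBr mulf_eq0 labs_eq0 oner_eq0 subr_eq0 => /eqP.
Qed.

Lemma labsB x y : labs (x - y) <= Num.max (labs x) (labs y).
Proof. by rewrite -(labsN R y); exact: labsD. Qed.

Lemma labsB_lt x y (e : R) : labs x < e -> labs y < e -> labs (x - y) < e.
Proof. by move=> xe ye; rewrite (le_lt_trans (labsB _ _))// gt_max xe. Qed.

Lemma labsD_lt x y (e : R) : labs x < e -> labs y < e -> labs (x + y) < e.
Proof. by move=> xe ye; rewrite (le_lt_trans (labsD _ _ _))// gt_max xe. Qed.

Lemma labs_sum_le (I : finType) (f : I -> F) (e : R) :
  0 <= e -> (forall i, labs (f i) <= e) -> labs (\sum_i f i) <= e.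
Proof.
move=> e0 h; elim/big_ind: _ => [|x y xe ye|//]; first by rewrite labs0.
by rewrite (le_trans (labsD _ _ _))// ge_max xe.
Qed.

Lemma lpoly_eq0 (p : {poly K}) : (lpoly p == 0) = (p == 0).
Proof.
apply/eqP/eqP => [h|->]; last exact: rmorph0.
apply/polyP => i; rewrite coef0.
by have := congr1 (fun x : F => lcoef x i%:Z) h.
Qed.

Lemma labs_lpoly_lt1 (p : {poly K}) : labs (lpoly p) < 1 -> p = 0.
Proof.
have -> : (1 : R) = expR 0%:~R by rewrite expR0.
move=> /labs_lt h; apply/polyP => i; rewrite coef0.
by have := h i%:Z isT.
Qed.

Fact lmonom_bound k : exists N : int, forall l, N < l ->
  (if l == k then 1 else 0 : K) = 0.
Proof. by exists k => l kl; rewrite gt_eqF. Qed.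

Definition lmonom k : F := Laurent (lmonom_bound k).

Lemma labs_lmonom k : labs (lmonom k) = expR k%:~R.
Proof.
apply/eqP; rewrite eq_le; apply/andP; split.
  by apply/labs_lbound => l kl /=; rewrite gt_eqF.
by apply: labs_coef; rewrite /= eqxx oner_eq0.
Qed.

(** Shifting by X^k makes the label a polynomial, so that there are countably many labels when K is
    finite. The length is a bound beyond which the coefficients vanish. At k = 0 this is the
    polynomial part of x. *)
Definition ltrunc k x : {poly K} :=
  \poly_(i < `|projT1 (cid (lcoef_bound x)) - k|.+1) lcoef x (k + i%:Z).

Lemma coef_ltrunc k x (i : nat) : (ltrunc k x)`_i = lcoef x (k + i%:Z).
Proof.
rewrite coef_poly; case: ifPn => //; rewrite -leqNgt; case: cid => N h /= ki.
by rewrite h//; lia.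
Qed.

Lemma ltruncP k x y :
  ltrunc k x = ltrunc k y <-> labs (x - y) < expR k%:~R.
Proof.
rewrite labs_lt; split=> [xy l kl|xy]; last first.
  apply/polyP => i; rewrite !coef_ltrunc; apply/eqP.
  by rewrite -subr_eq0 -lcoefB xy//; lia.
rewrite lcoefB (_ : l = k + (absz (l - k))%:Z); last by lia.
by rewrite -!coef_ltrunc xy subrr.
Qed.

Lemma labs_frac_lt1 x : labs (x - lpoly (ltrunc 0 x)) < 1.
Proof.
have -> : (1 : R) = expR 0%:~R by rewrite expR0.
apply/labs_lt => l l0; rewrite lcoefB /= l0 coef_ltrunc.
by rewrite (_ : 0 + _ = l) ?subrr//; lia.
Qed.

(** Nonzero absolute values are integral powers of e, and an integer is below ln r exactly when it
    is below the ceiling of ln r. *)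
Lemma labs_discrete x (r : R) : 0 < r ->
  (labs x < r) = (labs x < expR (Num.ceil (ln r))%:~R).
Proof.
move=> r0; have [->|x0] := eqVneq x 0; first by rewrite labs0 r0 expR_gt0.
rewrite labsE// -{1}[r]lnK ?posrE// !ltr_expR ltr_int.
by rewrite -ceil_gt_int.
Qed.

End Laurent.

(** * Truncation of matrices, and balls as cells *)

Section Matrices.
Variables (R : realType) (K : fieldType) (m n : nat).
Local Notation F := (laurent K).
Local Notation labs := (@labs R K).
Local Notation M := (matF K m n).
Implicit Types (Y Z : M) (k l : int).

Lemma supnorm_ltP m' n' (A : 'M[F]_(m', n')) (e : R) :
  supnorm R A < e <-> 0 < e /\ forall i j, labs (A i j) < e.
Proof.
split=> [/bigmax_ltP[e0 h]|[e0 h]].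
  by split=> // i j; exact: (h (i, j)).
by apply/bigmax_ltP; split=> // -[i j] _; exact: h.
Qed.

Lemma supnorm_ge m' n' (A : 'M[F]_(m', n')) i j : labs (A i j) <= supnorm R A.
Proof. exact: (le_bigmax _ (fun ij => labs (A ij.1 ij.2)) (i, j)). Qed.

Lemma supnorm_ge0 m' n' (A : 'M[F]_(m', n')) : 0 <= supnorm R A.
Proof. exact: bigmax_ge_id. Qed.

Definition mxtrunc k Y : 'M[{poly K}]_(m, n) := map_mx (ltrunc k) Y.

Lemma mxtruncP k Y Z :
  mxtrunc k Y = mxtrunc k Z <-> supnorm R (Y - Z) < expR k%:~R.
Proof.
rewrite supnorm_ltP; split=> [/matrixP h|[_ h]].
  split=> [|i j]; first exact: expR_gt0.
  by rewrite !mxE; apply/ltruncP; have := h i j; rewrite !mxE.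
apply/matrixP => i j; rewrite !mxE; apply/(ltruncP R).
by have := h i j; rewrite !mxE.
Qed.

Lemma mxtrunc_coarsen k l Y Z :
  k <= l -> mxtrunc k Y = mxtrunc k Z -> mxtrunc l Y = mxtrunc l Z.
Proof.
move=> kl /mxtruncP h; apply/mxtruncP; apply: lt_le_trans h _.
by rewrite ler_expR ler_int.
Qed.

Lemma ball_cell Y (r : R) : 0 < r ->
  ball Y r = cell mxtrunc (Num.ceil (ln r)) Y.
Proof.
move=> r0; apply/seteqP; split=> Z; rewrite mx_ball_supnorm.
  move=> /supnorm_ltP[_ h]; apply/esym/mxtruncP/supnorm_ltP.
  by split=> [|i j]; [exact: expR_gt0|rewrite -labs_discrete].
move=> /esym/mxtruncP/supnorm_ltP[_ h]; apply/supnorm_ltP.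
by split=> // i j; rewrite labs_discrete.
Qed.

Lemma cell_ball k Y : cell mxtrunc k Y = ball Y (expR k%:~R : R).
Proof. by rewrite ball_cell ?expR_gt0// expRK intrKceil. Qed.

Lemma open_cellP (A : set M) :
  open A <-> forall Y, A Y -> exists k, cell mxtrunc k Y `<=` A.
Proof.
rewrite openE; split=> h Y /h.
  move=> /(@nbhs_ballP R)[r /= r0 rA]; exists (Num.ceil (ln r)).
  by rewrite -ball_cell.
move=> [k]; rewrite cell_ball => kA; apply/(@nbhs_ballP R).
by exists (expR k%:~R) => //=; exact: expR_gt0.
Qed.

Lemma nbhs_cell Y (V : set M) : nbhs Y V -> exists k, cell mxtrunc k Y `<=` V.
Proof.
move=> /(@nbhs_ballP R)[r /= r0 rA]; exists (Num.ceil (ln r)).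
by rewrite -ball_cell.
Qed.

Lemma open_mxtrunc_preimage k (A : set 'M[{poly K}]_(m, n)) :
  open (mxtrunc k @^-1` A : set M).
Proof.
by apply/open_cellP => Y AY; exists k => Z /=; rewrite /cell/= => ->.
Qed.

End Matrices.

(** * Slabs *)

Section LinearForms.
Variables (R : realType) (K : fieldType) (m n : nat).
Local Notation F := (laurent K).
Local Notation labs := (@labs R K).
Local Notation M := (matF K m n).
Implicit Types (Y Z : M) (k l : int) (theta : 'cV[F]_m).
Implicit Types (p : 'cV[{poly K}]_m) (q : 'cV[{poly K}]_n).

Local Notation vnorm q := (supnorm R (map_mx (@lpoly K) q)).

Lemma labs_mulmx_le Y (v : 'cV[F]_n) j :
  labs ((Y *m v) j 0) <= supnorm R Y * supnorm R v.
Proof.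
rewrite mxE; apply: labs_sum_le => [|i]; first by rewrite mulr_ge0 ?supnorm_ge0.
by rewrite labsM ler_pM ?labs_ge0 ?supnorm_ge.
Qed.

Lemma lformB Y theta p p' q q' :
  lform Y theta p q - lform Y theta p' q' = lform Y 0 (p - p') (q - q').
Proof.
rewrite /lform !map_mxB mulmxBr addr0 opprD addrACA subrr addr0 opprD.
by rewrite addrACA.
Qed.

Lemma lform_sub Y Z theta p q :
  lform Z theta p q = lform Y theta p q + (Z - Y) *m map_mx (@lpoly K) q.
Proof. by rewrite /lform mulmxBl [RHS]addrC !addrA subrK. Qed.

Definition lslab p q theta (eps : 'I_m -> R) : set M :=
  [set Y | forall j, labs (lform Y theta p q j 0) < eps j].

Lemma open_lslab p q theta eps : open (lslab p q theta eps).
Proof.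
apply/(open_cellP R) => Y Yeps.
pose e0 : R := \big[Num.min/1]_j eps j.
have e00 : 0 < e0.
  apply: lt_bigmin => // j _; apply: le_lt_trans (Yeps j); exact: labs_ge0.
pose s := vnorm q; have s0 : 0 <= s by exact: supnorm_ge0.
(* Moving Y by less than e0 / (s + 1) changes each coordinate of the form by less than e0, which the
   ultrametric inequality absorbs. The + 1 covers s = 0. *)
exists (Num.floor (ln (e0 / (s + 1)))) => Z /esym/(mxtruncP R) YZ j.
rewrite (lform_sub Y) mxE; apply: labsD_lt => //.
have e0j : e0 <= eps j by apply/bigmin_leP; right; exists j.
apply: lt_le_trans e0j.
apply: le_lt_trans (labs_mulmx_le _ _ _) _; rewrite -/s.
have es : e0 / (s + 1) > 0 by rewrite divr_gt0//; lra.
have E : expR (Num.floor (ln (e0 / (s + 1))))%:~R <= e0 / (s + 1).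
  by rewrite -[leRHS]lnK ?posrE// ler_expR floor_le.
have {}YZ : supnorm R (Z - Y) < e0 / (s + 1).
  apply: lt_le_trans E; apply/(mxtruncP R).
  by apply/esym/(mxtruncP R).
have -> : e0 = e0 / (s + 1) * (s + 1) by field; lra.
by rewrite ltr_pM ?supnorm_ge0//; lra.
Qed.

(** Nonzero polynomials have degree at least 0, whence a natural d. The coordinate attaining the
    norm later shows that the normalised vector has norm 1. *)
Lemma vnorm_attained q : q != 0 ->
  exists2 d : nat, vnorm q = expR d%:R & exists i, labs (lpoly (q i 0)) = vnorm q.
Proof.
move=> q0; have [i0 qi0] : exists i, q i 0 != 0.
  apply/existsP; move: q0; apply: contraNT; rewrite negb_exists => /forallP h.
  by apply/eqP/matrixP => i j; rewrite ord1 mxE; apply/eqP; rewrite -[_ == _]negbK.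
have [i Ei] : exists i, vnorm q = labs (lpoly (q i 0)).
  rewrite /supnorm (@bigmax_eq_arg _ _ _ _ (i0, 0))//; last first.
    by move=> *; exact: labs_ge0.
  by case: arg_maxP => // -[i j] _ _ /=; exists i; rewrite mxE ord1.
have qi : q i 0 != 0.
  apply: contraNneq qi0 => qi.
  have := supnorm_ge R (map_mx (@lpoly K) q) i0 0.
  rewrite Ei qi rmorph0 labs0 mxE => h.
  by rewrite -lpoly_eq0 -(labs_eq0 R) eq_le h labs_ge0.
have li : lpoly (q i 0) != 0 by rewrite lpoly_eq0.
exists (absz (ldeg (lpoly (q i 0)))); last by exists i.
rewrite Ei labsE// pmulrn; congr (expR _%:~R).
have [+ _] := ldegP li; rewrite /=; case: ifP => [h _|_]; last by rewrite eqxx.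
by lia.
Qed.

(** Scaling by X^(-d), where e^d is the norm of q, makes the direction a unit vector and divides all
    widths by that norm. *)
Lemma lslab_slab p q theta : q != 0 ->
  exists b c, supnorm R b = 1 /\ forall eps,
    lslab p q theta eps = slab b c (fun j => eps j / vnorm q).
Proof.
move=> /vnorm_attained[d Ed [i Ei]]; pose t := lmonom K (- d%:Z).
have Et : labs t = (vnorm q)^-1.
  by rewrite labs_lmonom Ed -expRN mulrNz.
have vq : 0 < vnorm q by rewrite Ed expR_gt0.
exists (t *: map_mx (@lpoly K) q), (t *: (map_mx (@lpoly K) p + theta)); split.
  apply/eqP; rewrite eq_le; apply/andP; split.
    apply: bigmax_le => // -[i' j] _ /=; rewrite mxE labsM Et.
    by rewrite mulrC ler_pdivrMr// mul1r supnorm_ge.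
  apply: le_trans (supnorm_ge _ _ i 0); rewrite !mxE labsM Et Ei.
  by rewrite mulVf// gt_eqF.
move=> e; rewrite /slab /lslab; apply: eq_set => Y; apply: eq_forall => j.
rewrite -scalemxAr -scalerDr addrA -/(lform Y theta p q) [in RHS]mxE labsM Et.
by rewrite mulrC ltr_pM2r// invr_gt0.
Qed.

End LinearForms.

(** * Borel measures on matrices *)

Section BorelMeasures.
Variables (R : realType) (K : finFieldType) (m n : nat).
Local Notation F := (laurent K).
Local Notation labs := (@labs R K).
Local Notation M := (matF K m n).
Local Notation vnorm q := (supnorm R (map_mx (@lpoly K) q)).
Local Notation tr := (@mxtrunc K m n : int -> borelF K m n -> 'M[{poly K}]_(m, n)).
Implicit Types (Y Z : M) (k : int) (theta : 'cV[F]_m).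
Implicit Types (nu mu : {measure set (borelF K m n) -> \bar R}).

Lemma open_measurable_borelF (A : set M) :
  open A -> measurable (A : set (borelF K m n)).
Proof. exact: sub_sigma_algebra. Qed.

Lemma measurable_mxtrunc k (A : set 'M[{poly K}]_(m, n)) :
  measurable (tr k @^-1` A).
Proof. by apply: open_measurable_borelF; exact: (open_mxtrunc_preimage R). Qed.

Lemma measurable_ball Y (r : R) :
  0 < r -> measurable (ball Y r : set (borelF K m n)).
Proof. by move=> r0; rewrite ball_cell//; exact: (measurable_mxtrunc _ [set _]). Qed.

Lemma measurable_lslab p q theta (eps : 'I_m -> R) :
  measurable (lslab p q theta eps : set (borelF K m n)).
Proof. by apply: open_measurable_borelF; exact: open_lslab. Qed.

(** There are countably many cells, and [cell_union_null] treats all those meeting [P] in a null set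
    at once; this does the work of the Lindelof property. *)
Lemma null_of_locally_null mu (U P : set (borelF K m n)) :
  measurable P -> (forall Y, U Y -> exists k, mu (cell tr k Y `&` P) = 0%E) ->
  mu.-negligible (U `&` P).
Proof.
move=> mP h.
pose A k : set 'M[{poly K}]_(m, n) :=
  [set c | exists2 Y, tr k Y = c & mu (cell tr k Y `&` P) = 0%E].
exists (cell_union tr A `&` P); split.
- by apply: measurableI => //; apply: measurable_cell_union; exact: measurable_mxtrunc.
- apply: cell_union_null => //.
  + by move=> k l Y Z kl; exact: (mxtrunc_coarsen R kl).
  + exact: measurable_mxtrunc.
  + by move=> k Y [Z ZY]; rewrite /cell ZY.
- move=> Y [UY PY]; split=> //; have [k k0] := h Y UY.
  by exists k => //; exists Y.
Qed.

Lemma measurable_support nu : measurable (support nu : set (borelF K m n)).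
Proof.
rewrite -[support nu]setCK; apply: measurableC; apply: open_measurable_borelF.
by rewrite openC; apply: closed_bigI => C [].
Qed.

Lemma measure_setC_support nu : nu (~` support nu) = 0%E.
Proof.
apply: measure_negligible.
  by apply: measurableC; exact: measurable_support.
rewrite -[X in _.-negligible X]setIT; apply: null_of_locally_null => // Y.
move=> /existsNP[C /not_implyP[[cC C0] CY]].
have [k kC] := (open_cellP R (~` C)).1 (closed_openC cC) Y CY.
exists k; apply/eqP; rewrite -measure_le0 -C0 setIT; apply: le_measure.
- by rewrite inE; exact: (measurable_mxtrunc k [set tr k Y]).
- by rewrite inE; apply: open_measurable_borelF; rewrite openC.
- exact: kC.
Qed.

(** Three doublings suffice, as 5 <= 8. *)
Lemma doubling_5 nu : doubling nu -> exists2 c : R, 0 < c &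
  forall Y (r : R), support nu Y -> 0 < r ->
    (nu (ball Y (5 * r)) <= c%:E * nu (ball Y r))%E.
Proof.
move=> [c c0 h]; exists (c * c * c); first by rewrite !mulr_gt0.
move=> Y r SY r0; have c0' : (0 <= c%:E)%E by rewrite lee_fin ltW.
apply: (@le_trans _ _ (nu (ball Y (2 * (2 * (2 * r)))))).
  apply: le_measure; rewrite ?inE; try by apply: measurable_ball; lra.
  by apply: le_ball; lra.
apply: le_trans (h _ _ SY _) _; first by lra.
rewrite !EFinM -!muleA; apply: lee_pmul => //.
apply: le_trans (h _ _ SY _) _; first by lra.
by apply: lee_pmul => //; exact: h.
Qed.

(** Normalising q keeps the least width below [r0], because a nonzero polynomial vector has norm at
    least 1. Doubling bounds the measure of 5B by that of B, so one cell, B itself, serves both the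
    inclusion and the estimate. *)
Lemma contracts_lslab (P : set ('I_m -> R)) nu :
  doubling nu -> contracts P nu ->
  exists C alpha r0 : R, [/\ 0 < C, 0 < alpha, 0 < r0 &
    forall p q theta (eps : 'I_m -> R) (delta : R) Y,
      q != 0 -> (forall j, 0 < eps j) -> P (fun j => eps j / vnorm q) ->
      (exists j, eps j < r0) -> 0 < delta < 1 ->
      lslab p q theta (fun j => delta * eps j) Y -> support nu Y ->
      exists k, cell tr k Y `&` support nu `<=` lslab p q theta eps /\
        (nu (cell tr k Y `&` lslab p q theta (fun j => delta * eps j)%R) <=
          (C * delta `^ alpha)%:E * nu (cell tr k Y))%E].
Proof.
move=> /doubling_5[c c0 dbl] [C [alpha [r0 [C0 alpha0 r00 h]]]].
exists (C * c), alpha, r0; split=> //; first exact: mulr_gt0.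
move=> p q theta eps delta Y q0 eps0 Peps [j epsj] delta01 Yl SY.
have [d Ed _] := vnorm_attained R q0.
have v1 : 1 <= vnorm q by rewrite Ed -[leLHS]expR0 ler_expR.
have v0 : 0 < vnorm q by exact: lt_le_trans v1.
have [b [c' [b1 E]]] := lslab_slab R p theta q0.
have Ed' : lslab p q theta (fun j => delta * eps j) =
    slab b c' (fun j => delta * (eps j / vnorm q)).
  by rewrite E; congr slab; apply/funext => i; rewrite mulrA.
have [|||r [r_gt0 rS rl]] :=
    h b c' (fun j => eps j / vnorm q) delta b1 _ Peps _ delta01 Y _ SY.
- by move=> i; exact: divr_gt0.
- exists j; apply: le_lt_trans epsj.
  by rewrite ler_pdivrMr// ler_peMr// ltW.
- by rewrite -Ed'.
have ml : measurable (lslab p q theta (fun j => delta * eps j) : set (borelF K m n)).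
  exact: measurable_lslab.
exists (Num.ceil (ln r)); rewrite -ball_cell//; split; first by rewrite E.
have m5 : measurable (ball Y (5 * r) : set (borelF K m n)).
  by apply: measurable_ball; rewrite mulr_gt0.
have mr : measurable (ball Y r : set (borelF K m n)) by exact: measurable_ball.
apply: (@le_trans _ _ (nu (ball Y (5 * r) `&` lslab p q theta (fun j => delta * eps j)))).
  apply: le_measure; rewrite ?inE; [exact: measurableI..|].
  by apply: setSI; apply: le_ball; lra.
rewrite Ed'; apply: le_trans rl _; rewrite mulrAC [in leRHS]EFinM -muleA.
by apply: lee_pmul => //; [rewrite lee_fin mulr_ge0 ?powR_ge0// ltW|exact: dbl].
Qed.

End BorelMeasures.

(** * Transference for contracting measures *)

Section LocalTransference.
Import numFieldNormedType.Exports.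
Variables (R : realType) (K : finFieldType) (m n : nat).
Local Notation F := (laurent K).
Local Notation labs := (@labs R K).
Local Notation M := (matF K m n).
Local Notation vnorm q := (supnorm R (map_mx (@lpoly K) q)).
Local Notation tr := (@mxtrunc K m n : int -> borelF K m n -> 'M[{poly K}]_(m, n)).
Local Notation polypair := ('cV[{poly K}]_m * 'cV[{poly K}]_n)%type.
Implicit Types (nu mu : {measure set (borelF K m n) -> \bar R}).

(** The growth permitted to the number of box shapes: it cannot offset the exponential gain from
    contraction. *)
Definition subexponential (c : nat -> nat) : Prop :=
  forall rho : R, 0 < rho ->
    exists2 C : R, 0 <= C & forall N, (c N)%:R <= C * expR (rho * N%:R).

Lemma exponential_series_lty (C r : R) : 0 <= C -> 0 < r ->
  (\sum_(N <oo) (C * expR (- (r * N%:R)))%:E < +oo)%E.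
Proof.
move=> C0 r0; pose z := expR (- r).
have z1 : `|z| < 1 by rewrite ger0_norm ?expR_ge0// expR_lt1 oppr_lt0.
have E N : C * expR (- (r * N%:R)) = geometric C z N.
  by rewrite /= -expRM_natr mulNr.
apply: (@le_lt_trans _ _ (C * (1 - z)^-1)%:E); last exact: ltry.
apply: lime_le; first by apply: is_cvg_nneseries => *; rewrite lee_fin mulr_ge0 ?expR_ge0.
apply: nearW => N; rewrite sumEFin lee_fin.
rewrite (eq_bigr (geometric C z)) => [|i _]; last exact: E.
have cz := @cvg_geometric_series _ C _ z1; rewrite -(cvg_lim _ cz)//.
apply: (@nondecreasing_cvgn_le _ (series (geometric C z))).
  apply: nondecreasing_series => i _ _ /=; rewrite -expRM_natr.
  by rewrite mulr_ge0// expR_ge0.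
by apply/cvg_ex; eexists; exact: cz.
Qed.

(** Shrinking by e^(-sN) gains a factor C e^(-s alpha N). Half of the exponent s alpha pays for the
    number of boxes, and the other half makes the series converge. *)
Lemma local_transference (P : set ('I_m -> R)) nu theta (H : (set M)^nat)
    (B : nat -> finType) (Adm : forall N, B N -> polypair -> Prop)
    (eps : forall N, B N -> 'I_m -> R) (s : R) :
  (nu setT < +oo)%E -> doubling nu -> contracts P nu -> 0 < s ->
  (forall N, open (H N)) -> nu (lim_sup_set H) = 0%E ->
  subexponential (fun N => #|B N|) ->
  (forall N t j, 0 < eps N t j) ->
  (forall N t a, Adm N t a -> a.2 != 0 /\ P (fun j => eps N t j / vnorm a.2)) ->
  (forall r, 0 < r -> exists N0, forall N t a, (N0 <= N)%N -> Adm N t a ->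
     exists j, eps N t j < r) ->
  (exists N0, forall N t a b Y, (N0 <= N)%N -> a <> b ->
     Adm N t a -> Adm N t b -> lslab a.1 a.2 theta (eps N t) Y ->
     lslab b.1 b.2 theta (eps N t) Y -> H N Y) ->
  nu (lim_sup_set (fun N => \bigcup_t \bigcup_(a in Adm N t)
    lslab a.1 a.2 theta (fun j => expR (- (s * N%:R)) * eps N t j))) = 0%E.
Proof.
move=> nufin dbl ctr s0 oH H0 card eps0 AdmP epsr [N1 disj].
have [C [alpha [r0 [C0 alpha0 r00 h]]]] := contracts_lslab dbl ctr.
have [N2 N2r] := epsr _ r00.
pose delta N := expR (- (s * N%:R)).
(* Inadmissible pairs get the empty slab, so that the index runs over the whole countable type of
   pairs. *)
pose L N t (a : polypair) : set M :=
  if pselect (Adm N t a) then lslab a.1 a.2 theta (eps N t) else set0.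
pose l N t (a : polypair) : set M :=
  if pselect (Adm N t a) then
    lslab a.1 a.2 theta (fun j => delta N * eps N t j) else set0.
pose kap N := C * delta N `^ alpha.
rewrite (_ : (fun N => _) = fun N => \bigcup_t \bigcup_a l N t a); last first.
  apply/funext => N; apply: eq_bigcupr => t _; rewrite bigcup_mkcond.
  apply: eq_bigcupr => a _; rewrite /l; case: pselect => Ha.
    by rewrite mem_set.
  by rewrite memNset.
(* The 1 in the starting height ensures [delta N < 1]. *)
apply: (@transference _ (borelF K m n) R _ tr nu _ _ nufin H (support nu) B _
  L l kap (maxn 1 (maxn N1 N2))) => //.
- by move=> k l' Y Z kl; exact: (mxtrunc_coarsen R kl).
- exact: (measurable_mxtrunc R).
- by move=> N; exact: open_measurable_borelF.
- exact: measurable_support.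
- exact: measure_setC_support.
- move=> N t a; rewrite /L; case: (pselect (Adm N t a)) => ? //=.
  exact: measurable_lslab.
- move=> N t a; rewrite /l; case: (pselect (Adm N t a)) => ? //=.
  exact: measurable_lslab.
- by move=> N; rewrite /kap mulr_ge0 ?powR_ge0// ltW.
- have sa0 : 0 < s * alpha / 2 by rewrite divr_gt0// mulr_gt0.
  have [C1 C10 hC1] := card _ sa0.
  apply: le_lt_trans (exponential_series_lty (mulr_ge0 C10 (ltW C0)) sa0).
  apply: lee_nneseries => [N _ _|N _].
    by rewrite lee_fin /kap !mulr_ge0 ?powR_ge0// ltW.
  rewrite lee_fin /kap /delta -expRM.
  apply: (@le_trans _ _ (C1 * expR (s * alpha / 2 * N%:R) *
      (C * expR (- (s * N%:R) * alpha)))).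
    by apply: ler_wpM2r => //; rewrite mulr_ge0 ?expR_ge0// ltW.
  rewrite mulrACA -expRD [X in expR X](_ : _ = - (s * alpha / 2 * N%:R))//.
  by field.
- move=> N t a b Y; rewrite !geq_max => /and3P[_ N1N _] ab.
  rewrite /L; case: (pselect (Adm N t a)) => // Aa.
  by case: (pselect (Adm N t b)) => // Ab; exact: disj.
- move=> N t a Y; rewrite !geq_max => /and3P[N_gt0 _ N2N].
  rewrite /l /L; case: (pselect (Adm N t a)) => // Aa lY SY.
  have [q0 Pa] := AdmP _ _ _ Aa.
  apply: h => //; first exact: (N2r _ _ _ N2N Aa).
  by rewrite expR_gt0 expR_lt1 oppr_lt0 mulr_gt0// ltr0n.
Qed.

(** Around almost every point some restriction of [mu] satisfies [Q]; if it kills [P], then [mu]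
    kills [P] on a cell around that point, and local nullness suffices. Restrictions keep the null
    sets of [mu], which passes the homogeneous hypothesis on to them. *)
Lemma negligible_of_locally (Q : {measure set (borelF K m n) -> \bar R} -> Prop)
    mu (P : set (borelF K m n)) :
  almost_everywhere_locally Q mu -> measurable P ->
  (forall nu, Q nu -> (forall A, mu A = 0%E -> measurable A -> nu A = 0%E) ->
    nu P = 0%E) ->
  mu.-negligible P.
Proof.
move=> ae mP h; pose U : set (borelF K m n) := [set Y0 |
  exists (V : set (borelF K m n)) (mV : measurable V),
      nbhs (Y0 : M) (V : set M) /\ Q (mrestr mu mV)].
apply: (@negligibleS _ _ _ mu ((U `&` P) `|` ~` U)).
  by move=> Y PY; have [UY|] := pselect (U Y); [left|right].
apply: negligibleU; last exact: ae.
apply: null_of_locally_null => // Y [V [mV [/(nbhs_cell R)[k kV] QV]]].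
exists k; have := h _ QV; rewrite /mrestr => PV.
have mk : measurable (cell tr k Y : set (borelF K m n)).
  exact: (measurable_mxtrunc R k [set tr k Y]).
apply/eqP; rewrite -measure_le0 -PV => [|A A0 mA].
  by apply: le_measure; rewrite ?inE; [exact: measurableI..|];
    rewrite setIC; exact: setIS.
apply/eqP; rewrite -measure_le0 -A0; apply: le_measure; rewrite ?inE//.
exact: measurableI.
Qed.

End LocalTransference.

(** * The sup norm exponent *)

Section Exponents.
Variables (R : realType) (K : finFieldType) (m n : nat).
Local Notation F := (laurent K).
Local Notation labs := (@labs R K).
Local Notation M := (matF K m n).
Local Notation vnorm q := (supnorm R (map_mx (@lpoly K) q)).
Implicit Types (nu mu : {measure set (borelF K m n) -> \bar R}).
Implicit Types (Y Z : M) (theta : 'cV[F]_m) (w T : R).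
Implicit Types (p : 'cV[{poly K}]_m) (q : 'cV[{poly K}]_n).
Hypotheses (m_gt0 : (0 < m)%N) (n_gt0 : (0 < n)%N).

Lemma lform_coord Y theta p q j : lform Y theta p q j 0 =
  (Y *m map_mx (@lpoly K) q) j 0 + lpoly (p j 0) + theta j 0.
Proof. by rewrite /lform !mxE. Qed.

Lemma lform_q0 Y p j : lform Y 0 p 0 j 0 = lpoly (p j 0).
Proof. by rewrite lform_coord map_mx0 mulmx0 !mxE add0r addr0. Qed.

Lemma supnorm_expr_lt k (y : 'cV[F]_k) (d : nat) (a : R) : (0 < d)%N ->
  supnorm R y ^+ d < expR a <-> forall j, labs (y j 0) < expR (a / d%:R).
Proof.
move=> d0; have E : expR a = expR (a / d%:R) ^+ d.
  by rewrite -expRM_natr divfK// pnatr_eq0 -lt0n.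
rewrite E ltr_pXn2r ?nnegrE ?supnorm_ge0 ?expR_ge0//.
rewrite supnorm_ltP; split=> [[_ h] j //|h].
by split=> [|i j]; [exact: expR_gt0|rewrite ord1].
Qed.

(** Integral heights make the points approximable at arbitrarily large heights the limsup of a
    sequence. Taking the m-th root turns the first condition into a slab with equal widths, the case
    that contracting measures control. *)
Definition approx w theta (N : nat) : set M := [set Y | exists p q,
  [/\ q != 0, vnorm q ^+ n < expR N%:R &
      lslab p q theta (fun _ => expR (- (w * N%:R) / m%:R)) Y]].

Lemma open_approx w theta N : open (approx w theta N).
Proof.
apply/(open_cellP R) => Y [p [q [q0 qN Yl]]].
have [k kl] := (open_cellP R _).1 (@open_lslab R K m n p q theta _) Y Yl.
by exists k => Z /kl; exists p, q.
Qed.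

(* Rounding T up to an integer costs a bounded factor, which is absorbed by
   passing from a larger exponent w' to w. *)
Lemma exponent_round w w' (T0 : R) : 0 <= w -> w < w' ->
  exists T1 : R, forall T, T1 <= T -> exists N : nat,
    [/\ T0 <= N%:R, T <= N%:R & w * N%:R <= w' * T].
Proof.
(* With N the ceiling of T, w N <= w (T + 1) <= w' T as soon as T >= w / (w' - w). *)
move=> w0 ww'; exists (Num.max T0 (Num.max 0 (w / (w' - w)))) => T.
rewrite !ge_max => /and3P[T0T T_ge0 wT]; exists (absz (Num.ceil T)).
have ceil0 : 0 <= Num.ceil T by rewrite ceil_ge0; apply: lt_le_trans T_ge0; lra.
have -> : (absz (Num.ceil T))%:R = (Num.ceil T)%:~R :> R.
  by rewrite natr_absz ger0_norm.
have h1 := ceil_ge T; have h2 : (Num.ceil T)%:~R < T + 1.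
  have := ceilB1_lt T; lra.
split=> //; first exact: le_trans h1.
rewrite ler_pdivrMr in wT; last by lra.
by nra.
Qed.

Lemma omega_gt_approx w Y theta : 0 <= w -> (w%:E < omega R Y theta)%E ->
  lim_sup_set (approx w theta) Y.
Proof.
move=> w0 /ereal_sup_gt[_ [w' [w'0 h] <-]]; rewrite lte_fin => ww' N0 _.
have [T1 hT1] := exponent_round N0%:R w0 ww'.
have [T /hT1[N [N0N TN wN]] [_ [p [q [q0 hp hq]]]]] := h T1.
exists N; first by rewrite /= -(ler_nat R).
exists p, q; split=> //; first by apply: lt_le_trans hq _; rewrite ler_expR.
apply/(supnorm_expr_lt _ _ m_gt0); apply: lt_le_trans hp _.
by rewrite ler_expR lerN2.
Qed.

Lemma approx_omega_ge w Y theta : 0 <= w ->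
  lim_sup_set (approx w theta) Y -> (w%:E <= omega R Y theta)%E.
Proof.
move=> w0 h; apply: ereal_sup_ubound; exists w => //; split=> // T0.
have [N /= T0N [p [q [q0 hq hp]]]] := h (absz (Num.ceil (Num.max T0 1))) Logic.I.
have : Num.max T0 1 <= N%:R.
  by apply: le_trans (ceil_absz_ge _) _; rewrite ler_nat.
rewrite ge_max => /andP[T0N' N1]; exists N%:R => //; split=> //.
by exists p, q; split=> //; apply/(supnorm_expr_lt _ _ m_gt0).
Qed.

Lemma subexponential_cst (c : nat) : subexponential R (fun=> c).
Proof.
move=> r r0; exists c%:R => // N.
by rewrite ler_peMr// -[leLHS]expR0 ler_expR mulr_ge0// ltW.
Qed.

Lemma expR_eventually_lt (a r : R) : 0 < a -> 0 < r ->
  exists N0 : nat, forall N, (N0 <= N)%N -> expR (- (a * N%:R)) < r.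
Proof.
move=> a0 r0; exists (absz (Num.ceil (- ln r / a))).+1 => N.
rewrite -(ltr_nat R) => hN.
rewrite -[ltRHS]lnK ?posrE// ltr_expR ltrNl mulrC -ltr_pdivrMr//.
by apply: le_lt_trans hN; exact: ceil_absz_ge.
Qed.

Lemma local_null_approx nu theta w w' : 0 < w -> w < w' ->
  contracting nu -> nu (lim_sup_set (approx w 0)) = 0%E ->
  nu (lim_sup_set (approx w' theta)) = 0%E.
Proof.
move=> w0 ww' [nufin _ dbl ctr] H0.
have m0 : 0 < m%:R :> R by rewrite ltr0n.
(* With this s, shrinking by e^(-sN) turns the widths for w into those for w'. There is one box
   shape per height. *)
pose s := (w' - w) / m%:R.
pose Adm (N : nat) (_ : unit) (a : 'cV[{poly K}]_m * 'cV[{poly K}]_n) :=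
  a.2 != 0 /\ vnorm a.2 ^+ n < expR N%:R.
pose eps (N : nat) (_ : unit) (_ : 'I_m) := expR (- (w * N%:R) / m%:R) : R.
have -> : approx w' theta = fun N => \bigcup_t \bigcup_(a in Adm N t)
    lslab a.1 a.2 theta (fun j => expR (- (s * N%:R)) * eps N t j).
  apply/funext => N.
  have E : expR (- (s * N%:R)) * expR (- (w * N%:R) / m%:R) =
      expR (- (w' * N%:R) / m%:R).
    by rewrite -expRD; congr expR; rewrite /s; field; rewrite gt_eqF.
  apply/seteqP; split=> [Y [p [q [q0 qN Yl]]]|Y [t _ [[p q] [q0 qN]]]].
    by exists tt => //; exists (p, q) => // j; rewrite /eps E; exact: Yl.
  by rewrite /eps E => Yl; exists p, q.
apply: (local_transference nufin dbl ctr _ _ H0).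
- by rewrite divr_gt0// subr_gt0.
- by move=> N; exact: open_approx.
- exact: subexponential_cst.
- by move=> N t j; exact: expR_gt0.
- by move=> N t a [].
- move=> r r0; have wm : 0 < w / m%:R by rewrite divr_gt0.
  have [N0 hN0] := expR_eventually_lt wm r0.
  exists N0 => N t a /hN0 hN _; exists (Ordinal m_gt0).
  by rewrite /eps mulNr mulrAC; exact: hN.
exists 0%N => N t [p q] [p' q'] Y _ pq [/= _ qN] [/= _ q'N] Yl Yl'.
have Yd j : labs (lform Y 0 (p - p') (q - q') j 0) < expR (- (w * N%:R) / m%:R).
  rewrite -(lformB Y theta) mxE [X in _ + X]mxE; exact: labsB_lt.
exists (p - p'), (q - q'); split=> //; last first.
  apply/(supnorm_expr_lt _ _ n_gt0) => i; rewrite map_mxB mxE [X in _ + X]mxE.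
  by apply: labsB_lt; [move/(supnorm_expr_lt _ _ n_gt0): qN|
     move/(supnorm_expr_lt _ _ n_gt0): q'N].
(* If q = q', the form is the polynomial vector p - p' with entries of absolute value below 1, hence
   0. *)
rewrite subr_eq0; apply/eqP => qq; apply: pq; congr (_, _) => //.
apply/eqP; rewrite -subr_eq0; apply/eqP/matrixP => j k; rewrite ord1 [RHS]mxE.
apply: (@labs_lpoly_lt1 R); rewrite -(lform_q0 Y) -(subrr q) {2}qq.
apply: lt_le_trans (Yd j) _; rewrite -expR0 ler_expR mulNr oppr_le0.
by rewrite divr_ge0// mulr_ge0// ltW.
Qed.

(** Taking all entries of q equal to 1 and p minus the polynomial part of Yq attains exponent 0 at
    every height N >= 1. This is what reduces the transference to [eta >= 0]. *)
Lemma omega_ge0 Y : (0 <= omega R Y 0)%E.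
Proof.
apply: approx_omega_ge => // N0 _; exists (maxn N0 1); first exact: leq_maxl.
pose q : 'cV[{poly K}]_n := const_mx 1.
exists (- map_mx (ltrunc 0) (Y *m map_mx (@lpoly K) q)), q; split.
- apply/eqP => /matrixP/(_ (Ordinal n_gt0) 0)/eqP.
  by rewrite !mxE oner_eq0.
- apply/(supnorm_expr_lt _ _ n_gt0) => i; rewrite !mxE rmorph1 labs1.
  by rewrite -[ltLHS]expR0 ltr_expR divr_gt0// ltr0n// leq_maxr.
- move=> j; rewrite lform_coord mul0r oppr0 mul0r expR0 !mxE addr0 rmorphN.
  exact: labs_frac_lt1.
Qed.

End Exponents.

(** * The multiplicative exponent *)

Section MultiplicativeExponents.
Variables (R : realType) (K : finFieldType) (m n : nat).
Local Notation F := (laurent K).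
Local Notation labs := (@labs R K).
Local Notation M := (matF K m n).
Local Notation vnorm q := (supnorm R (map_mx (@lpoly K) q)).
Implicit Types (nu mu : {measure set (borelF K m n) -> \bar R}).
Implicit Types (Y Z : M) (theta : 'cV[F]_m) (w T : R).
Implicit Types (p : 'cV[{poly K}]_m) (q : 'cV[{poly K}]_n).
Hypotheses (m_gt0 : (0 < m)%N) (n_gt0 : (0 < n)%N).

(* Boxes with integral sides: the factor exp(-a_j) exceeds |y_j| by at most e,
   unless a_j has reached the cap L, in which case a_j alone is large enough. *)
Lemma integral_box (y : 'I_m -> F) (x : R) (L : nat) : x <= L%:R ->
  (forall j, labs (y j) < 1) -> \prod_j labs (y j) < expR (- x) ->
  exists a : 'I_m -> nat, [/\ forall j, (a j <= L)%N,
    x - m%:R <= \sum_j (a j)%:R & forall j, labs (y j) < expR (- (a j)%:R)].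
Proof.
move=> xL y1 yx.
pose b j := absz (ldeg (y j)).
have yb j : y j != 0 -> labs (y j) = expR (- (b j)%:R) /\ (0 < b j)%N.
  move=> yj0; have := y1 j; rewrite labsE// expR_lt1 ltrz0 => d0.
  split; last by rewrite /b; lia.
  congr expR; rewrite /b natr_absz ltr0_norm// mulrNz opprK.
  by [].
pose a j := if y j == 0 then L else minn (b j).-1 L.
exists a; split=> [j||j].
- by rewrite /a; case: ifP => // _; exact: geq_minr.
- have [[j aj]|noL] := pselect (exists j, (L <= a j)%N).
    rewrite (bigD1 j)//= lerBlDr.
    have s0 : 0 <= \sum_(i < m | i != j) (a i)%:R :> R by exact: sumr_ge0.
    have : (L%:R : R) <= (a j)%:R by rewrite ler_nat.
    have : 0 <= m%:R :> R by [].
    lra.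
  have aE j : y j != 0 /\ (a j).+1 = b j.
    have : ~~ (L <= a j)%N by apply/negP => h; apply: noL; exists j.
    rewrite /a; case: eqVneq => [_|yj0]; first by rewrite leqnn.
    by have [_ +] := yb j yj0; lia.
  move: yx; rewrite (eq_bigr (fun j => expR (- ((a j)%:R + 1)))); last first.
    by move=> j _; have [/yb[-> _] <-] := aE j; rewrite natr1.
  rewrite -expR_sum ltr_expR sumrN ltrN2 big_split /= sumr_const card_ord.
  by rewrite lerBlDr => /ltW.
rewrite /a; case: eqVneq => [->|/yb[-> b0]]; first by rewrite labs0 expR_gt0.
rewrite ltr_expR ltrN2 ltr_nat; lia.
Qed.

Definition cap w (N : nat) : nat := absz (Num.ceil (w * N%:R)).

Lemma cap_ge w N : w * N%:R <= (cap w N)%:R.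
Proof. exact: ceil_absz_ge. Qed.

Lemma cap_le w N : 0 <= w -> (cap w N)%:R <= w * N%:R + 1.
Proof.
move=> w0; rewrite natr_absz ger0_norm.
  by have := ceilB1_lt (w * N%:R); lra.
by rewrite ceil_ge0; apply: lt_le_trans (_ : 0 <= _); rewrite ?ltrN10// mulr_ge0.
Qed.

(** The cap keeps the number of boxes polynomial in N, and [m%:R] is the loss from rounding the
    sides. *)
Definition approx_box w theta (N : nat) : set M :=
  [set Y | exists p q (a : 'I_m -> nat),
  [/\ q != 0, prodabs_plus R q < expR N%:R, forall j, (a j <= cap w N)%N,
      w * N%:R - m%:R <= \sum_j (a j)%:R
    & lslab p q theta (fun j => expR (- (a j)%:R) : R) Y]].

Definition approx_mul w (N : nat) : set M := [set Y | exists p q (b : 'I_m -> R),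
  [/\ q != 0, prodabs_plus R q < expR N%:R, w * N%:R <= \sum_j b j
    & lslab p q 0 (fun j => expR (- b j)) Y]].

Lemma open_approx_box w theta N : open (approx_box w theta N).
Proof.
apply/(open_cellP R) => Y [p [q [a [q0 qN aL aw Yl]]]].
have [k kl] := (open_cellP R _).1 (@open_lslab R K m n p q theta _) Y Yl.
by exists k => Z /kl; exists p, q, a.
Qed.

Lemma open_approx_mul w N : open (approx_mul w N).
Proof.
apply/(open_cellP R) => Y [p [q [b [q0 qN bw Yl]]]].
have [k kl] := (open_cellP R _).1 (@open_lslab R K m n p q 0 _) Y Yl.
by exists k => Z /kl; exists p, q, b.
Qed.

Lemma omega_mul_gt_approx w Y theta : 0 <= w -> (w%:E < omega_mul R Y theta)%E ->
  lim_sup_set (approx_box w theta) Y.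
Proof.
move=> w0 /ereal_sup_gt[_ [w' [w'0 h] <-]]; rewrite lte_fin => ww' N0 _.
have [T1 hT1] := exponent_round N0%:R w0 ww'.
have [T /hT1[N [N0N TN wN]] [_ [p [q [q0 hp hq]]]]] := h T1.
exists N; first by rewrite /= -(ler_nat R).
pose v := Y *m map_mx (@lpoly K) q + theta.
(* Coordinates of absolute value at least 1 are replaced by fractional parts. The product does not
   increase, and all coordinates are below 1, as [integral_box] requires. *)
pose p' : 'cV[{poly K}]_m := \col_j
  if labs (lform Y theta p q j 0) < 1 then p j 0 else - ltrunc 0 (v j 0).
have lp' j : labs (lform Y theta p' q j 0) < 1 /\
    labs (lform Y theta p' q j 0) <= labs (lform Y theta p q j 0).
  have [l1|l1] := ltP (labs (lform Y theta p q j 0)) 1.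
    have -> : lform Y theta p' q j 0 = lform Y theta p q j 0.
      by rewrite !lform_coord [p' j 0]mxE l1.
    by [].
  have f1 : labs (lform Y theta p' q j 0) < 1.
    have -> : lform Y theta p' q j 0 = v j 0 - lpoly (ltrunc 0 (v j 0)).
      rewrite lform_coord [p' j 0]mxE ltNge l1 /= rmorphN.
      by rewrite addrAC; congr (_ - _); rewrite [RHS]mxE.
    exact: labs_frac_lt1.
  by split=> //; apply: le_trans l1; exact: ltW.
have [|||a [aL aw ya]] :=
    @integral_box (fun j => lform Y theta p' q j 0) (w * N%:R) (cap w N).
- exact: cap_ge.
- by move=> j; have [] := lp' j.
- apply: le_lt_trans (_ : _ <= prodabs R (lform Y theta p q)) _.
    by apply: ler_prod => j _; rewrite labs_ge0; have [_ ->] := lp' j.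
  by apply: lt_le_trans hp _; rewrite ler_expR lerN2.
exists p', q, a; split=> //.
by apply: lt_le_trans hq _; rewrite ler_expR.
Qed.

Lemma approx_omega_mul_ge w Y : 0 <= w ->
  lim_sup_set (approx_mul w) Y -> (w%:E <= omega_mul R Y 0)%E.
Proof.
move=> w0 h; apply: ereal_sup_ubound; exists w => //; split=> // T0.
have [N /= T0N [p [q [b [q0 hq bw Yl]]]]] :=
  h (absz (Num.ceil (Num.max T0 1))) Logic.I.
have : Num.max T0 1 <= N%:R.
  by apply: le_trans (ceil_absz_ge _) _; rewrite ler_nat.
rewrite ge_max => /andP[T0N' N1]; exists N%:R => //; split=> //.
exists p, q; split=> //.
apply: lt_le_trans (_ : \prod_j expR (- b j) <= _).
  apply: ltr_prod => [|j _]; last by rewrite labs_ge0 Yl.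
  by apply/hasP; exists (Ordinal m_gt0) => //; exact: mem_index_enum.
by rewrite -expR_sum ler_expR sumrN lerN2.
Qed.

Lemma omega_mul_ge0 Y : (0 <= omega_mul R Y 0)%E.
Proof.
apply: approx_omega_mul_ge => // N0 _; exists (maxn N0 1); first exact: leq_maxl.
pose q : 'cV[{poly K}]_n := const_mx 1.
exists (- map_mx (ltrunc 0) (Y *m map_mx (@lpoly K) q)), q, (fun=> 0); split.
- apply/eqP => /matrixP/(_ (Ordinal n_gt0) 0)/eqP.
  by rewrite !mxE oner_eq0.
- rewrite /prodabs_plus big1 => [|i _]; last by rewrite mxE rmorph1 labs1 maxxx.
  by rewrite -[ltLHS]expR0 ltr_expR ltr0n leq_maxr.
- by rewrite mul0r big1.
- move=> j; rewrite lform_coord oppr0 expR0 !mxE addr0 rmorphN.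
  exact: labs_frac_lt1.
Qed.

Lemma subexponential_affine_expn (c : nat -> nat) (a b : R) (k : nat) :
  0 <= a -> 0 <= b -> (forall N, (c N)%:R <= a * N%:R + b) ->
  subexponential R (fun N => (c N ^ k)%N).
Proof.
move=> a0 b0 cab r r0; pose r' := r / k.+1%:R.
have r'0 : 0 < r' by rewrite divr_gt0.
pose C := a / r' + b; have C0 : 0 <= C by rewrite addr_ge0// divr_ge0// ltW.
exists (C ^+ k) => [|N]; first exact: exprn_ge0.
rewrite natrX.
have h : (c N)%:R <= C * expR (r' * N%:R).
  apply: le_trans (cab N) _; rewrite /C mulrDl lerD//; last first.
    by rewrite ler_peMr// -[leLHS]expR0 ler_expR mulr_ge0// ltW.
  rewrite -mulrA ler_wpM2l// mulrC ler_pdivlMr// mulrC.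
  by apply: le_trans (expR_ge1Dx _); lra.
apply: le_trans (_ : (C * expR (r' * N%:R)) ^+ k <= _).
  by apply: lerXn2r; rewrite ?nnegrE// mulr_ge0// expR_ge0.
rewrite exprMn ler_wpM2l ?exprn_ge0// -expRM_natr ler_expR /r'.
rewrite [leLHS](_ : _ = r * N%:R * (k%:R / k.+1%:R));
  last by ring.
rewrite ler_piMr//; first by rewrite mulr_ge0// ltW.
by rewrite ler_pdivrMr// mul1r ler_nat.
Qed.

Lemma subexponential_mul (c c' : nat -> nat) :
  subexponential R c -> subexponential R c' ->
  subexponential R (fun N => (c N * c' N)%N).
Proof.
move=> h h' r r0; have r2 : 0 < r / 2 by rewrite divr_gt0.
have [C C0 hC] := h _ r2; have [C' C'0 hC'] := h' _ r2.
exists (C * C') => [|N]; first exact: mulr_ge0.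
rewrite natrM; apply: le_trans (ler_pM _ _ (hC N) (hC' N)) _ => //.
by rewrite mulrACA -expRD -mulrDl -splitr.
Qed.

End MultiplicativeExponents.

(** * Transference for the multiplicative exponent *)

Section MultiplicativeTransference.
Variables (R : realType) (K : finFieldType) (m n : nat).
Local Notation F := (laurent K).
Local Notation labs := (@labs R K).
Local Notation M := (matF K m n).
Local Notation vnorm q := (supnorm R (map_mx (@lpoly K) q)).
Implicit Types (nu mu : {measure set (borelF K m n) -> \bar R}).
Implicit Types (Y Z : M) (theta : 'cV[F]_m) (w T : R).
Implicit Types (p : 'cV[{poly K}]_m) (q : 'cV[{poly K}]_n).
Hypotheses (m_gt0 : (0 < m)%N) (n_gt0 : (0 < n)%N).

(** A bound on [prodabs_plus] alone need not pass to a difference q - q', whereas bounds on the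
    single factors do; the exponents u therefore become part of the box shape. *)
Lemma integral_height q (N : nat) : prodabs_plus R q < expR N%:R ->
  exists u : 'I_n -> nat,
    [/\ forall i, (u i <= N)%N, forall i, Num.max 1 (labs (lpoly (q i 0))) = expR (u i)%:R
      & (\sum_i (u i)%:R : R) < N%:R].
Proof.
move=> qN.
pose u i := if lpoly (q i 0) == 0 then 0%N else absz (ldeg (lpoly (q i 0))).
have uE i : Num.max 1 (labs (lpoly (q i 0))) = expR (u i)%:R :> R.
  rewrite /u; case: eqVneq => [->|qi]; first by rewrite labs0 expR0 max_l.
  have [+ _] := ldegP qi; rewrite /=; case: ifP => [d0 _|_]; last by rewrite eqxx.
  rewrite labsE// natr_absz ger0_norm// max_r// -[leLHS]expR0 ler_expR.
  by rewrite ler0z.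
have uN : (\sum_i (u i)%:R : R) < N%:R.
  rewrite -ltr_expR expR_sum; apply: le_lt_trans qN.
  by rewrite /prodabs_plus (eq_bigr _ (fun i _ => uE i)).
exists u; split=> // i; rewrite -(ler_nat R); apply: le_trans (ltW uN).
by rewrite (bigD1 i)//= lerDl sumr_ge0.
Qed.

Lemma local_null_approx_bounded nu theta w w' (c : nat) : 0 < w -> w < w' ->
  strongly_contracting nu -> nu (lim_sup_set (approx_mul w)) = 0%E ->
  (forall j, labs (theta j 0) < expR c%:R) ->
  nu.-negligible (lim_sup_set (approx_box w' theta) `&`
    [set Y : borelF K m n | supnorm R (Y : M) < expR c%:R]).
Proof.
move=> w0 ww' [nufin _ dbl ctr] H0 thetac.
have m0 : 0 < m%:R :> R by rewrite ltr0n.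
have w'0 : 0 < w' by exact: lt_trans ww'.
(* Enlarging m sides by e^(sN) costs half of the gap (w' - w) N; the other half absorbs the rounding
   loss m once N is large. *)
pose s := (w' - w) / (m%:R * 2).
have s0 : 0 < s by rewrite divr_gt0 ?subr_gt0// mulr_gt0.
have sE : m%:R * s * 2 = w' - w by rewrite /s; field; rewrite gt_eqF.
pose B (N : nat) : finType :=
  ({ffun 'I_n -> 'I_N.+1} * {ffun 'I_m -> 'I_(cap w' N).+1})%type.
pose free N (t : B N) j := (t.2 j)%:R <= s * N%:R.
pose Adm N (t : B N) (a : 'cV[{poly K}]_m * 'cV[{poly K}]_n) :=
  [/\ a.2 != 0, forall i, Num.max 1 (labs (lpoly (a.2 i 0))) <= expR (t.1 i)%:R,
      (\sum_i (t.1 i)%:R : R) < N%:R,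
      w' * N%:R - m%:R <= \sum_j (t.2 j)%:R
    & forall j, free N t j -> a.1 j 0 = 0].
(* Coordinates with a_j <= s N would give slabs wider than 1, for which distinct
   p_j are no longer separated; such a coordinate is left free by setting
   p_j = 0 and taking a slab so wide that it contains the bounded region. *)
pose eps N (t : B N) j : R := if free N t j then expR (c%:R + N%:R + s * N%:R)
  else expR (- ((t.2 j)%:R - s * N%:R)).
have slack N : (2 * m%:R / (w' - w) <= N%:R) ->
    m%:R + m%:R * s * N%:R <= (w' - w) * N%:R.
  by rewrite ler_pdivrMr ?subr_gt0// -sE => h; nra.
have [N1 hN1] : exists N1 : nat, forall N, (N1 <= N)%N ->
    m%:R + m%:R * s * N%:R <= (w' - w) * N%:R.
  exists (absz (Num.ceil (2 * m%:R / (w' - w)))) => N hN; apply: slack.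
  by apply: le_trans (ceil_absz_ge _) _; rewrite ler_nat.
exists (lim_sup_set (fun N => \bigcup_t \bigcup_(a in Adm N t)
    lslab a.1 a.2 theta (fun j => expR (- (s * N%:R)) * eps N t j))); split.
- apply: measurable_lim_sup_set => N.
  apply: measurable_bigcup_countType => t.
  apply: open_measurable_borelF; apply: bigcup_open => a _.
  exact: open_lslab.
- apply: (local_transference nufin dbl ctr s0 _ H0).
  + by move=> N; exact: open_approx_mul.
  + rewrite (_ : (fun N => _) = fun N => (N.+1 ^ n * (cap w' N).+1 ^ m)%N).
      apply: subexponential_mul.
        apply: (@subexponential_affine_expn R S 1 1) => // N.
        by rewrite mul1r natr1.
      apply: (@subexponential_affine_expn R (fun N => (cap w' N).+1) w' 2) => // [|N].
        exact: ltW.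
      by rewrite -natr1; have := cap_le N (ltW w'0); lra.
    by apply/funext => N; rewrite card_prod !card_ffun !card_ord.
  + by move=> N t j; rewrite /eps; case: ifP => _; exact: expR_gt0.
  + by move=> N t a [].
  + move=> r r0; have wm : 0 < w / m%:R by rewrite divr_gt0.
    have [N0 hN0] := expR_eventually_lt wm r0.
    exists (maxn (maxn 1 N0) N1) => N t a.
    rewrite !geq_max => /andP[/andP[N_gt0 /hN0 hN] /hN1 hs] [_ _ _ ta _].
    (* Pigeonhole: if every a_j - sN were below (w / m) N, the sum of the a_j would be below wN +
       msN <= w'N - m, against admissibility. *)
    have [[j hj]|nj] := pselect (exists j, w / m%:R * N%:R <= (t.2 j)%:R - s * N%:R).
      exists j; rewrite /eps ifF.
        by apply: le_lt_trans hN; rewrite ler_expR lerN2.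
      apply/negbTE; rewrite /free -ltNge -subr_gt0.
      by apply: lt_le_trans hj; rewrite mulr_gt0// ltr0n.
    exfalso; have : \sum_j (t.2 j)%:R < \sum_(j < m) (w / m%:R * N%:R + s * N%:R).
      apply: ltr_sum => [|j _].
        by apply/hasP; exists (Ordinal m_gt0) => //; exact: mem_index_enum.
      by rewrite -ltrBlDr ltNge; apply/negP => hj; apply: nj; exists j.
    rewrite sumr_const card_ord -[X in _ < X]mulr_natr.
    have -> : (w / m%:R * N%:R + s * N%:R) * m%:R = w * N%:R + m%:R * s * N%:R.
      by field; rewrite gt_eqF.
    lra.
  exists N1 => N t [p q] [p' q'] Y /hN1 hs pq [/= _ qu uN ta pfree].
  move=> [/= _ q'u _ _ p'free] Yl Yl'.
  have Yd j : ~~ free N t j ->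
      labs (lform Y 0 (p - p') (q - q') j 0) < expR (- ((t.2 j)%:R - s * N%:R)).
    move=> fj; rewrite -(lformB Y theta) mxE [X in _ + X]mxE.
    by apply: labsB_lt; [have := Yl j|have := Yl' j]; rewrite /eps (negbTE fj).
  pose v := Y *m map_mx (@lpoly K) (q - q').
  (* In a free coordinate the polynomial part of Y(q - q') is removed instead; the remaining value
     is below 1, within the width e^(sN - a_j) because a_j <= sN. *)
  pose p'' : 'cV[{poly K}]_m := \col_j
    if free N t j then - ltrunc 0 (v j 0) else p j 0 - p' j 0.
  exists p'', (q - q'), (fun j => (t.2 j)%:R - s * N%:R); split.
  + rewrite subr_eq0; apply/eqP => qq; apply: pq; congr (_, _) => //.
    apply/matrixP => j k; rewrite ord1; have [fj|fj] := boolP (free N t j).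
      by rewrite pfree// p'free.
    apply/eqP; rewrite -subr_eq0; apply/eqP; apply: (@labs_lpoly_lt1 R).
    have := Yd _ fj; rewrite qq subrr lform_q0 !mxE => /lt_le_trans; apply.
    by rewrite -[leRHS]expR0 ler_expR oppr_le0 subr_ge0 ltW// ltNge.
  + apply: le_lt_trans (_ : expR (\sum_i (t.1 i)%:R) < _); last by rewrite ltr_expR.
    rewrite expR_sum; apply: ler_prod => i _; rewrite le_max ler01 /=.
    rewrite !mxE rmorphB ge_max; apply/andP; split.
      by apply: le_trans (qu i); rewrite le_max lexx.
    apply: le_trans (labsB _ _ _) _; rewrite ge_max.
    apply/andP; split; [apply: le_trans (qu i)|apply: le_trans (q'u i)];
      by rewrite le_max lexx orbT.
  + rewrite sumrB sumr_const card_ord -[X in _ - X]mulr_natr.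
    by rewrite (mulrC _ m%:R) mulrA; lra.
  + move=> j; have [fj|fj] := boolP (free N t j); last first.
      have -> : lform Y 0 p'' (q - q') j 0 = lform Y 0 (p - p') (q - q') j 0.
        rewrite !lform_coord [p'' j 0]mxE (negbTE fj).
        by rewrite [(p - p') j 0]mxE [(- p') j 0]mxE.
      exact: Yd.
    apply: (@lt_le_trans _ _ 1); last first.
      by rewrite -[leLHS]expR0 ler_expR oppr_ge0 subr_le0.
    rewrite lform_coord [p'' j 0]mxE fj [(0 : 'cV_m) j 0]mxE addr0 rmorphN.
    exact: labs_frac_lt1.
(* Each solution gets the shape given by its exponents u and its box a, and its entries of p in free
   coordinates are reset to 0. *)
- move=> Y [Ylim Yc] N0 _; have [N N0N [p [q [a [q0 qN aL aw Yl]]]]] := Ylim N0 Logic.I.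
  exists N => //; have [u [uN uE us]] := integral_height qN.
  pose t : B N := ([ffun i => inord (u i)], [ffun j => inord (a j)]).
  have t1 i : (t.1 i = u i :> nat) by rewrite ffunE inordK ?ltnS.
  have t2 j : (t.2 j = a j :> nat) by rewrite ffunE inordK ?ltnS.
  exists t => //.
  pose p' : 'cV[{poly K}]_m := \col_j if free N t j then 0 else p j 0.
  exists (p', q); first split=> //=.
  + by move=> i; rewrite t1 uE.
  + by under eq_bigr do rewrite t1.
  + by under eq_bigr do rewrite t2.
  + by move=> j fj; rewrite mxE fj.
  move=> j; rewrite /= /eps; case: ifPn => fj; last first.
    have -> : lform Y theta p' q j 0 = lform Y theta p q j 0.
      by rewrite !lform_coord [p' j 0]mxE (negbTE fj).
    rewrite -expRD t2 (_ : _ + _ = - (a j)%:R); first exact: Yl.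
    by ring.
  (* Here Y and theta have norm below e^c and q has norm below e^N, so the shrunken free slab, of
     width e^(c + N), still contains Y. *)
  rewrite -expRD (_ : - _ + _ = c%:R + N%:R); last by ring.
  rewrite lform_coord [p' j 0]mxE fj rmorph0 addr0.
  apply: labsD_lt; last first.
    by apply: lt_le_trans (thetac j) _; rewrite ler_expR lerDl.
  apply: le_lt_trans (labs_mulmx_le _ _ _ _) _; rewrite expRD.
  apply: ltr_pM => //; rewrite ?supnorm_ge0//.
  apply/supnorm_ltP; split=> [|i k]; first exact: expR_gt0.
  rewrite ord1 mxE; apply: le_lt_trans (_ : expR (u i)%:R < _).
    by rewrite -uE le_max lexx orbT.
  rewrite ltr_expR; apply: le_lt_trans us.
  by rewrite (bigD1 i)//= lerDl sumr_ge0.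
Qed.

(** The balls of radius e^(c0 + c) exhaust the space, and c0 is large enough for theta as well. *)
Lemma local_null_approx_box nu theta w w' : 0 < w -> w < w' ->
  strongly_contracting nu -> nu (lim_sup_set (approx_mul w)) = 0%E ->
  nu (lim_sup_set (approx_box w' theta)) = 0%E.
Proof.
move=> w0 ww' sc H0.
apply: measure_negligible.
  apply: measurable_lim_sup_set => N; apply: open_measurable_borelF.
  exact: open_approx_box.
have bound x : exists c : nat, x < expR c%:R :> R.
  exists (absz (Num.ceil x)); apply: lt_le_trans (_ : 1 + x <= _); first by lra.
  apply: le_trans (expR_ge1Dx _) _; rewrite ler_expR.
  exact: ceil_absz_ge.
have [c0 hc0] := bound (supnorm R theta).
apply: (@negligibleS _ _ _ nu (\bigcup_c (lim_sup_set (approx_box w' theta) `&`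
    [set Y : borelF K m n | supnorm R (Y : M) < expR (c0 + c)%N%:R]))).
  move=> Y Yl; have [c hc] := bound (supnorm R (Y : M)).
  exists c => //; split=> //; apply: lt_le_trans hc _.
  by rewrite ler_expR ler_nat leq_addl.
apply: negligible_bigcup => c; apply: local_null_approx_bounded w0 ww' sc H0 _ => j.
apply: le_lt_trans (supnorm_ge _ _ _ _) _; apply: lt_le_trans hc0 _.
by rewrite ler_expR ler_nat leq_addr.
Qed.

End MultiplicativeTransference.

(** * From local to global *)

Section Globalisation.
Variables (R : realType) (K : finFieldType) (m n : nat).
Local Notation M := (matF K m n).
Implicit Types (mu nu : {measure set (borelF K m n) -> \bar R}).

(* Only the countably many levels eta + 1/(i+1) matter; between two
   consecutive ones there is room for the transference. *)
Lemma ae_exponent_le (Q : {measure set (borelF K m n) -> \bar R} -> Prop) mu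
    (omega0 omega1 : M -> \bar R) (A0 A1 : R -> (set M)^nat) (eta : \bar R) :
  almost_everywhere_locally Q mu ->
  (forall w N, open (A0 w N)) -> (forall w N, open (A1 w N)) ->
  (forall Y, (0 <= omega0 Y)%E) ->
  (forall w Y, 0 <= w -> lim_sup_set (A0 w) Y -> (w%:E <= omega0 Y)%E) ->
  (forall w Y, 0 <= w -> (w%:E < omega1 Y)%E -> lim_sup_set (A1 w) Y) ->
  (forall nu w w', 0 < w -> w < w' -> Q nu -> nu (lim_sup_set (A0 w)) = 0%E ->
     nu (lim_sup_set (A1 w')) = 0%E) ->
  {ae mu, forall Y : borelF K m n, omega0 Y = eta} ->
  {ae mu, forall Y : borelF K m n, (omega1 Y <= eta)%E}.
Proof.
move=> locQ oA0 oA1 om0 A0om A1om trans etaE.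
(* Nothing is to be proved for +oo. For -oo, and below for negative eta, [omega0 >= 0] makes the
   whole space negligible. *)
case: eta etaE => [eta||] etaE; last 2 first.
- by apply: negligibleS (negligible_set0 mu) => Y /=; rewrite leey.
- apply: negligibleS etaE => Y _ /= omY.
  by have := om0 Y; rewrite omY.
have [eta0|eta0] := ltP eta 0.
  apply: negligibleS etaE => Y _ /= omY.
  by have := om0 Y; rewrite omY lee_fin leNgt eta0.
have mA0 w : measurable (lim_sup_set (A0 w) : set (borelF K m n)).
  by apply: measurable_lim_sup_set => N; exact: open_measurable_borelF.
have mA1 w : measurable (lim_sup_set (A1 w) : set (borelF K m n)).
  by apply: measurable_lim_sup_set => N; exact: open_measurable_borelF.
have null0 w : eta < w -> mu (lim_sup_set (A0 w)) = 0%E.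
  move=> ew; apply: measure_negligible => //; apply: negligibleS etaE => Y /= Yw.
  move=> omY; have w0 : 0 <= w by lra.
  by have := A0om w Y w0 Yw; rewrite omY lee_fin leNgt ew.
have null1 w : eta < w -> mu.-negligible (lim_sup_set (A1 w) : set (borelF K m n)).
  move=> ew; apply: (negligible_of_locally locQ) => // nu Qnu nunull.
  (* The midpoint is positive since eta >= 0, and lies above eta, so its homogeneous limsup is
     null. *)
  apply: (trans nu ((eta + w) / 2)) => //; [lra|lra|].
  by apply: nunull => //; apply: null0; lra.
apply: (@negligibleS _ _ _ mu
    (\bigcup_i (lim_sup_set (A1 (eta + i.+1%:R^-1)) : set (borelF K m n)))).
  move=> Y /= /negP; rewrite -ltNge => etaY.
  have [w etaw wY] : exists2 w, eta < w & (w%:E < omega1 Y)%E.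
    case: (omega1 Y) etaY => [r||//]; last by exists (eta + 1); rewrite ?ltry; lra.
    by rewrite lte_fin => er; exists ((eta + r) / 2); rewrite ?lte_fin; lra.
  have [i iw] : exists i : nat, eta + i.+1%:R^-1 < w.
    have we : 0 < w - eta by lra.
    exists (absz (Num.ceil (w - eta)^-1)); rewrite -ltrBrDl.
    rewrite -[ltRHS]invrK ltf_pV2 ?posrE ?invr_gt0//.
    by apply: le_lt_trans (ceil_absz_ge _) _; rewrite -natr1 ltrDl.
  exists i => //; apply: A1om; first by rewrite addr_ge0// invr_ge0.
  by apply: lt_trans wY; rewrite lte_fin.
by apply: negligible_bigcup => i; apply: null1; rewrite ltrDl invr_gt0.
Qed.

End Globalisation.

Theorem theorem2p4 (R : realType) (p d m n : nat) (K : finFieldType)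
    (hp : prime p) (hd : (0 < d)%N) (hK : #|K| = (p ^ d)%N)
    (hm : (0 < m)%N) (hn : (0 < n)%N) :
  (forall (mu : {measure set (borelF K m n) -> \bar R}) (eta : \bar R),
     contracting_ae mu ->
     {ae mu, forall Y : borelF K m n, omega R Y 0 = eta} ->
     forall theta : 'cV[laurent K]_m,
       {ae mu, forall Y : borelF K m n, (omega R Y theta <= eta)%E}) /\
  (forall (mu : {measure set (borelF K m n) -> \bar R}) (eta : \bar R),
     strongly_contracting_ae mu ->
     {ae mu, forall Y : borelF K m n, omega_mul R Y 0 = eta} ->
     forall theta : 'cV[laurent K]_m,
       {ae mu, forall Y : borelF K m n, (omega_mul R Y theta <= eta)%E}).
Proof.
split=> mu eta ctr etaE theta.
- apply: (ae_exponent_le (A0 := fun w => approx w 0)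
    (A1 := fun w => approx w theta) ctr _ _ _ _ _ _ etaE).
  + by move=> w N; exact: open_approx.
  + by move=> w N; exact: open_approx.
  + exact: omega_ge0.
  + by move=> w Y; exact: approx_omega_ge.
  + by move=> w Y; exact: omega_gt_approx.
  + by move=> nu w w'; exact: local_null_approx.
- apply: (ae_exponent_le (A0 := fun w => @approx_mul R K m n w)
    (A1 := fun w => approx_box w theta) ctr _ _ _ _ _ _ etaE).
  + by move=> w N; exact: open_approx_mul.
  + by move=> w N; exact: open_approx_box.
  + exact: omega_mul_ge0.
  + by move=> w Y; exact: approx_omega_mul_ge.
  + by move=> w Y; exact: omega_mul_gt_approx.
  + by move=> nu w w'; exact: local_null_approx_box.
Qed.
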